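(* Suppose that $B$ is an integral domain containing a field $\mathbf{k}$ of characteristic zero. Let $G$ be a totally ordered abelian group and $\deg : B\to G\cup\{-\infty\}$ a degree function. Then, in each of the cases (a)–(d) below, $\deg$ is tame over $\mathbf{k}$: (a) $B$ is finitely generated as a $\mathbf{k}$-algebra and $\deg$ is determined by some $G$-grading of $B$. (b) $\operatorname{Gr}(B)$ is finitely generated as a $\mathbf{k}$-algebra and $\{\deg(x) : x\in B\setminus\{0\}\}$ is a well-ordered subset of $G$. (c) $\operatorname{trdeg}_{\mathbf{k}}(B)<\infty$, $\operatorname{Frac}(B)$ is a one-dimensional function field over the field of fractions of the ring $\{x\in B : \deg(x)\le 0\}$, and $\deg$ has values in $\mathbb{N}$. (d) $\operatorname{trdeg}_{\mathbf{k}}(B)<\infty$ and $\deg=\deg_\Delta$ for some locally nilpotent derivation $\Delta : B\to B$.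
   Context: A degree function on a ring $B$ with values in a totally ordered abelian group $G$ is a map $\deg : B \to G\cup\{-\infty\}$ such that for all $x,y\in B$: (1) $\deg(x)=-\infty$ iff $x=0$; (2) $\deg(xy)=\deg x+\deg y$; (3) $\deg(x+y)\le\max(\deg x,\deg y)$. ''Values in $\mathbb{N}$'' means $G=\mathbb{Z}$ and $\deg(x)\in\mathbb{N}$ (with $0\in\mathbb{N}$) for all $x\neq0$. For a derivation $D:B\to B$ of an integral domain $B$ with degree function $\deg$, let $U=\{\deg(Dx)-\deg(x) : x\in B\setminus\{0\}\}\subseteq G\cup\{-\infty\}$. If $U$ has a greatest element, $\deg(D)$ is defined to be that element; otherwise $\deg(D)$ is not defined. For $A\subseteq B$ integral domains of characteristic zero, $\deg$ is tame over $A$ if $\deg(D)$ is defined for all $A$-derivations $D:B\to B$. Degree function determined by a grading: if $B=\bigoplus_{i\in G}B_i$ is a $G$-grading, the degree function determined by it sends $x=\sum_i x_i$ ($x_i\in B_i$) to the greatest element of $\{i\in G: x_i\ne0\}\cup\{-\infty\}$. Associated graded ring: for $i\in G$ put $B_{\le i}=\{x\in B:\deg(x)\le i\}$, $B_{<i}=\{x\in B:\deg(x)<i\}$, $B_{[i]}=B_{\le i}/B_{<i}$; then $\operatorname{Gr}(B)=\bigoplus_{i\in G}B_{[i]}$, with multiplication induced by that of $B$. In case (b), well-orderedness implies that every $x\neq 0$ has $\deg(x)\ge0$, so elements of $\mathbf{k}^*$ have degree $0$ and $\operatorname{Gr}(B)$ is a $\mathbf{k}$-algebra via $\mathbf{k}\to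 B_{\le 0}\to B_{[0]}$. $\operatorname{trdeg}_{\mathbf{k}}(B)$ is the transcendence degree of $\operatorname{Frac}(B)$ over $\mathbf{k}$. A one-dimensional function field is a finitely generated field extension of transcendence degree $1$. A derivation $\Delta:B\to B$ is locally nilpotent if for each $x\in B$ there is $n$ with $\Delta^n(x)=0$; then $\deg_\Delta:B\to\mathbb{N}\cup\{-\infty\}$ is the degree function $\deg_\Delta(x)=\max\{n\in\mathbb{N}:\Delta^n(x)\neq0\}$ for $x\ne0$, $\deg_\Delta(0)=-\infty$. *)

(* Defs.v *)
From HB Require Import structures.
From mathcomp Require Import all_boot all_order all_algebra.
From mathcomp Require Import generic_quotient ring_quotient fraction.
From mathcomp Require Import boolp.
From mathcomp Require Import mpoly.

Set Implicit Arguments.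
Unset Strict Implicit.
Unset Printing Implicit Defensive.

Import Order.TTheory GRing.Theory Num.Theory.
Local Open Scope ring_scope.
Local Open Scope quotient_scope.

(* Totally ordered abelian groups.  Totality is an axiom here rather than
   inherited from Order.Total: HB would otherwise ask for the missing joins of
   the lattice structures with those of the algebraic hierarchy. *)
HB.mixin Record isTotallyOrderedZmodule G of Num.POrderedZmodule G := {
  toag_le_total : total (<=%R : rel G);
  toag_leD2r : forall z x y : G, x <= y -> x + z <= y + z
}.

#[short(type="toagType")]
HB.structure Definition TotallyOrderedZmodule :=
  {G of Num.POrderedZmodule G & isTotallyOrderedZmodule G}.

Fact int_leD2r (z x y : int) : x <= y -> x + z <= y + z.
Proof. by rewrite lerD2r. Qed.
HB.instance Definition _ :=
  isTotallyOrderedZmodule.Build int le_total int_leD2r.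

(* G \cup {-oo} is [option G], with [None] standing for -oo. *)
Section WithBottom.
Variable G : toagType.
Implicit Types a b : option G.

Definition le_bot a b : bool :=
  match a, b with
  | None, _ => true
  | Some i, Some j => i <= j
  | Some _, None => false
  end.
Definition lt_bot a b : bool := ~~ le_bot b a.
Definition max_bot a b : option G := if le_bot a b then b else a.
Definition add_bot a b : option G :=
  match a, b with
  | Some i, Some j => Some (i + j)
  | _, _ => None
  end.
(* [sub_bot a b] is only meaningful for b <> -oo. *)
Definition sub_bot a b : option G := add_bot a (omap -%R b).

Definition is_greatest (U : option G -> Prop) a : Prop :=
  U a /\ forall b, U b -> le_bot b a.

End WithBottom.

Record degree_function (B : comNzRingType) (G : toagType) := DegreeFunction {
  deg_fun :> B -> option G;
  deg_eq_bot : forall x, deg_fun x = None <-> x = 0;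
  degM : forall x y, deg_fun (x * y) = add_bot (deg_fun x) (deg_fun y);
  degD : forall x y,
    le_bot (deg_fun (x + y)) (max_bot (deg_fun x) (deg_fun y))
}.

Section Derivations.
Variables (B : idomainType) (G : toagType).
Implicit Types (D : B -> B) (deg : degree_function B G).

Definition derivation D : Prop :=
  (forall x y, D (x + y) = D x + D y) /\
  (forall x y, D (x * y) = D x * y + x * D y).

(* A is seen as a subring of B through the (injective) morphism iota. *)
Definition derivation_over (A : idomainType) (iota : {rmorphism A -> B}) D :=
  derivation D /\ forall a, D (iota a) = 0.

Definition degree_shifts deg D : option G -> Prop :=
  fun u => exists2 x : B, x != 0 & u = sub_bot (deg (D x)) (deg x).

Definition is_degree_of_derivation deg D (u : option G) : Prop :=
  is_greatest (degree_shifts deg D) u.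

Definition degree_of_derivation_defined deg D : Prop :=
  exists u, is_degree_of_derivation deg D u.

Definition tame (A : idomainType) (iota : {rmorphism A -> B}) deg : Prop :=
  forall D, derivation_over iota D -> degree_of_derivation_defined deg D.

Definition locally_nilpotent D : Prop :=
  forall x, exists n, iter n D x = 0.

End Derivations.

(* R is the only k-subalgebra of R containing s. *)
Definition fg_algebra (k R : comNzRingType) (iota : {rmorphism k -> R}) : Prop :=
  exists s : seq R, forall A : {pred R},
    subring_closed A -> (forall c, iota c \in A) -> {subset s <= A} ->
    forall x, x \in A.

Section Gradings.
Variables (B : idomainType) (G : toagType).

Record is_grading (Bi : G -> B -> Prop) : Prop := IsGrading {
  grading0 : forall i, Bi i 0;
  gradingB : forall i x y, Bi i x -> Bi i y -> Bi i (x - y);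
  gradingM : forall i j x y, Bi i x -> Bi j y -> Bi (i + j) (x * y);
  grading_span : forall x, exists (s : seq G) (f : G -> B),
    [/\ uniq s, forall i, Bi i (f i) & x = \sum_(i <- s) f i];
  grading_free : forall (s : seq G) (f : G -> B),
    uniq s -> (forall i, Bi i (f i)) -> \sum_(i <- s) f i = 0 ->
    forall i, i \in s -> f i = 0
}.

(* deg x is the greatest element of {i | x_i <> 0} \cup {-oo}, where
   x = \sum_(i <- s) f i is the decomposition of x, i.e. x_i = f i for i in s
   and x_i = 0 otherwise. *)
Definition determined_by (Bi : G -> B -> Prop) (deg : B -> option G) : Prop :=
  forall (s : seq G) (f : G -> B), uniq s -> (forall i, Bi i (f i)) ->
  is_greatest
    (fun a => a = None \/ exists i, [/\ i \in s, f i != 0 & a = Some i])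
    (deg (\sum_(i <- s) f i)).

End Gradings.

Section TotallyOrderedTheory.
Variable G : toagType.
Implicit Types (i j : G) (a b c : option G).

Lemma le_bot_refl a : le_bot a a.
Proof. by case: a => //= i. Qed.

Lemma le_bot_trans b a c : le_bot a b -> le_bot b c -> le_bot a c.
Proof. by case: a b c => [i|] [j|] [l|] //=; apply: le_trans. Qed.

Lemma le_bot_total a b : le_bot a b || le_bot b a.
Proof. by case: a b => [i|] [j|] //=; apply: toag_le_total. Qed.

Lemma lt_botW a b : lt_bot a b -> le_bot a b.
Proof. by rewrite /lt_bot => /negPf ba; have := le_bot_total a b; rewrite ba orbF. Qed.

Lemma le_lt_bot_trans b a c : le_bot a b -> lt_bot b c -> lt_bot a c.
Proof. by move=> ab; apply: contra => ca; apply: le_bot_trans ca ab. Qed.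

Lemma le_max_bot a b c : le_bot a c -> le_bot b c -> le_bot (max_bot a b) c.
Proof. by rewrite /max_bot; case: ifP. Qed.

Lemma lt_max_bot a b c : lt_bot a c -> lt_bot b c -> lt_bot (max_bot a b) c.
Proof. by rewrite /max_bot; case: ifP. Qed.

Lemma le_add_bot a b a' b' :
  le_bot a a' -> le_bot b b' -> le_bot (add_bot a b) (add_bot a' b').
Proof.
case: a b a' b' => [i|] [j|] [i'|] [j'|] //= lei lej.
apply: le_trans (toag_leD2r _ _ _ lei) _.
by rewrite ![i' + _]addrC toag_leD2r.
Qed.

Lemma lt_le_add_bot a b i j :
  lt_bot a (Some i) -> le_bot b (Some j) -> lt_bot (add_bot a b) (Some (i + j)).
Proof.
case: a b => [i'|] [j'|] //= lti lej; apply: contra lti => le_ij.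
have /(le_trans le_ij) : i' + j' <= i' + j by rewrite ![i' + _]addrC toag_leD2r.
by move=> /(toag_leD2r (- j)); rewrite !addrK.
Qed.

End TotallyOrderedTheory.

Section DegreeTheory.
Variables (B : comNzRingType) (G : toagType) (deg : degree_function B G).

Lemma deg0 : deg 0 = None. Proof. exact/deg_eq_bot. Qed.

Lemma deg1 : deg 1 = Some 0.
Proof.
case e: (deg 1) => [i|]; last by move/deg_eq_bot/eqP: e; rewrite oner_eq0.
have := degM deg 1 1; rewrite mulr1 e /= => -[] /(congr1 (fun x => x - i)).
by rewrite subrr addrK => ->.
Qed.

Lemma degN1 : deg (-1) = Some 0.
Proof.
have := degM deg (-1) (-1); rewrite mulrNN mulr1 deg1.
case: (deg (-1)) => //= i [] e0; congr Some.
have := @toag_leD2r G; have /orP[le0|le0] := toag_le_total i 0 => leD.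
- by apply/eqP; rewrite eq_le le0 /= e0 -[leRHS]add0r leD.
- by apply/eqP; rewrite eq_le le0 andbT e0 -[leLHS]add0r leD.
Qed.

Lemma degN x : deg (- x) = deg x.
Proof. by rewrite -mulN1r degM degN1; case: (deg x) => //= i; rewrite add0r. Qed.

End DegreeTheory.

Section AssociatedGraded.
Variables (B : comNzRingType) (G : toagType) (deg : degree_function B G).
Implicit Types (i j n : G) (x y : B).

Definition filt_le i : {pred B} := fun x => le_bot (deg x) (Some i).

Fact filt_le_closed i : zmod_closed (filt_le i).
Proof.
split=> [|x y xi yi]; rewrite unfold_in /=; first by rewrite deg0.
by apply: le_bot_trans (degD _ _ _) _; rewrite degN; apply: le_max_bot.
Qed.
HB.instance Definition _ i :=
  GRing.isZmodClosed.Build B (filt_le i) (filt_le_closed i).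

Definition B_le i : Type := {x : B | x \in filt_le i}.
HB.instance Definition _ i := Choice.on (B_le i).
HB.instance Definition _ i := SubChoice.on (B_le i).
HB.instance Definition _ i :=
  [SubChoice_isSubZmodule of B_le i by <:].

Definition B_lt i : {pred B_le i} := fun u => lt_bot (deg (val u)) (Some i).

Fact B_lt_closed i : zmod_closed (@B_lt i).
Proof.
split=> [|x y xi yi]; rewrite unfold_in /=; first by rewrite deg0.
by apply: le_lt_bot_trans (degD _ _ _) _; rewrite degN; apply: lt_max_bot.
Qed.
HB.instance Definition _ i :=
  GRing.isZmodClosed.Build (B_le i) (@B_lt i) (@B_lt_closed i).

Definition gr_piece i : zmodType := Quotient.quot (@B_lt i : zmodClosed _).

(* The class of x in B_[i], meaningful for deg x <= i only. *)
Definition gr_class i x : gr_piece i := \pi_(gr_piece i) (insubd (0 : B_le i) x).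

Definition gr_rep i (u : gr_piece i) : B := val (repr u).

Lemma gr_rep_le i (u : gr_piece i) : le_bot (deg (gr_rep u)) (Some i).
Proof. exact: (valP (repr u)). Qed.

Lemma gr_repK i (u : gr_piece i) : gr_class i (gr_rep u) = u.
Proof. by rewrite /gr_class /gr_rep valKd reprK. Qed.

Lemma gr_classP i x y : le_bot (deg x) (Some i) -> le_bot (deg y) (Some i) ->
  (gr_class i x = gr_class i y) <-> lt_bot (deg (x - y)) (Some i).
Proof.
move=> xi yi; rewrite /gr_class; set X := insubd _ x; set Y := insubd _ y.
have -> : x - y = val (X - Y) by rewrite raddfB /= !insubdK.
rewrite -[lt_bot _ _]/(X - Y \in @B_lt i) Quotient.idealrBE.
by split=> [->|/eqP].
Qed.

Lemma gr_class0 i : gr_class i 0 = 0.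
Proof.
have -> : gr_class i 0 = \pi_(gr_piece i) 0.
  by congr \pi; apply: val_inj; rewrite insubdK ?rpred0.
by rewrite raddf0.
Qed.

Lemma gr_classD i x y : le_bot (deg x) (Some i) -> le_bot (deg y) (Some i) ->
  gr_class i (x + y) = gr_class i x + gr_class i y.
Proof.
move=> xi yi; rewrite /gr_class -raddfD; congr \pi; apply: val_inj.
by rewrite raddfD /= !insubdK // rpredD.
Qed.

Lemma le_deg_sum (I : Type) (s : seq I) (P : pred I) (F : I -> B) i :
  (forall l, P l -> le_bot (deg (F l)) (Some i)) ->
  le_bot (deg (\sum_(l <- s | P l) F l)) (Some i).
Proof.
move=> leF; elim/big_rec: _ => [|l x Pl xi]; first by rewrite deg0.
by apply: le_bot_trans (degD _ _ _) _; apply: le_max_bot => //; apply: leF.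
Qed.

Lemma gr_class_sum (I : Type) (s : seq I) (F : I -> B) i :
  (forall l, le_bot (deg (F l)) (Some i)) ->
  gr_class i (\sum_(l <- s) F l) = \sum_(l <- s) gr_class i (F l).
Proof.
move=> leF; elim: s => [|l s IHs]; first by rewrite !big_nil gr_class0.
by rewrite !big_cons gr_classD ?IHs //; apply: le_deg_sum.
Qed.

Lemma le_degM i j n x y : i + j = n ->
  le_bot (deg x) (Some i) -> le_bot (deg y) (Some j) ->
  le_bot (deg (x * y)) (Some n).
Proof. by move=> <- xi yj; rewrite degM; apply: (le_add_bot xi yj). Qed.

Lemma gr_classM i j n x x' y y' : i + j = n ->
  le_bot (deg x) (Some i) -> le_bot (deg x') (Some i) ->
  le_bot (deg y) (Some j) -> le_bot (deg y') (Some j) ->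
  gr_class i x = gr_class i x' -> gr_class j y = gr_class j y' ->
  gr_class n (x * y) = gr_class n (x' * y').
Proof.
move=> ijn xi x'i yj y'j /(gr_classP xi x'i) ltx /(gr_classP yj y'j) lty.
apply/gr_classP; [exact: le_degM xi yj | exact: le_degM x'i y'j |].
have -> : x * y - x' * y' = (x - x') * y + (y - y') * x'.
  by rewrite !mulrBl [x' * y]mulrC [x' * y']mulrC addrA subrK.
apply: le_lt_bot_trans (degD _ _ _) _; apply: lt_max_bot; rewrite degM -ijn.
  exact: lt_le_add_bot.
by rewrite [i + j]addrC; apply: lt_le_add_bot.
Qed.

(* Gr(B), the direct sum of the B_[i]. *)
Record gr : Type := MkGr {
  gr_coef :> forall i, gr_piece i;
  gr_finite : exists s : seq G, forall i, i \notin s -> gr_coef i = 0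
}.
HB.instance Definition _ := gen_eqMixin gr.
HB.instance Definition _ := gen_choiceMixin gr.
Implicit Types f g h : gr.

Lemma grP f g : (forall i, f i = g i) -> f = g.
Proof.
case: f g => [f pf] [g pg] /= fg.
have E : f = g by apply: functional_extensionality_dep.
by case: g / E pg fg => pg _; congr MkGr; apply: Prop_irrelevance.
Qed.

Definition gr_supp f : seq G := undup (sval (cid (gr_finite f))).

Lemma gr_supp_uniq f : uniq (gr_supp f). Proof. exact: undup_uniq. Qed.

Lemma gr_suppP f i : i \notin gr_supp f -> f i = 0.
Proof. by rewrite mem_undup; case: cid => s /= sP; apply: sP. Qed.

Fact gr_zero_finite :
  exists s : seq G, forall i, i \notin s -> (0 : gr_piece i) = 0.
Proof. by exists [::]. Qed.
Definition gr_zero : gr := MkGr gr_zero_finite.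

Fact gr_opp_finite f : exists s : seq G, forall i, i \notin s -> - f i = 0.
Proof. by exists (gr_supp f) => i /gr_suppP->; rewrite oppr0. Qed.
Definition gr_opp f : gr := MkGr (gr_opp_finite f).

Fact gr_add_finite f g :
  exists s : seq G, forall i, i \notin s -> f i + g i = 0.
Proof.
exists (gr_supp f ++ gr_supp g) => i; rewrite mem_cat negb_or.
by case/andP=> /gr_suppP-> /gr_suppP->; rewrite addr0.
Qed.
Definition gr_add f g : gr := MkGr (gr_add_finite f g).

Fact gr_addA : associative gr_add.
Proof. by move=> f g h; apply: grP => i /=; rewrite addrA. Qed.
Fact gr_addC : commutative gr_add.
Proof. by move=> f g; apply: grP => i /=; rewrite addrC. Qed.
Fact gr_add0 : left_id gr_zero gr_add.
Proof. by move=> f; apply: grP => i /=; rewrite add0r. Qed.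
Fact gr_addN : left_inverse gr_zero gr_opp gr_add.
Proof. by move=> f; apply: grP => i /=; rewrite addNr. Qed.
HB.instance Definition _ :=
  GRing.isZmodule.Build gr gr_addA gr_addC gr_add0 gr_addN.

(* The product B_[i] x B_[j] -> B_[n] induced by the product of B, where
   i + j = n; a separate n avoids transports along equalities in G. *)
Definition gr_piece_mul n i j (u : gr_piece i) (v : gr_piece j) : gr_piece n :=
  gr_class n (gr_rep u * gr_rep v).

Definition gr_mul_coef f g n : gr_piece n :=
  \sum_(i <- gr_supp f) gr_piece_mul n (f i) (g (n - i)).

Lemma gr_piece_mulE n i j x y : i + j = n ->
  le_bot (deg x) (Some i) -> le_bot (deg y) (Some j) ->
  gr_piece_mul n (gr_class i x) (gr_class j y) = gr_class n (x * y).
Proof.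
by move=> ijn xi yj; apply: (gr_classM ijn); rewrite ?gr_repK ?gr_rep_le.
Qed.

Lemma gr_piece_mulDl n i j (u v : gr_piece i) (w : gr_piece j) : i + j = n ->
  gr_piece_mul n (u + v) w = gr_piece_mul n u w + gr_piece_mul n v w.
Proof.
move=> ijn; rewrite /gr_piece_mul -gr_classD ?(le_degM ijn) ?gr_rep_le //.
rewrite -mulrDl.
have uv : le_bot (deg (gr_rep u + gr_rep v)) (Some i).
  by apply: le_bot_trans (degD _ _ _) _; apply: le_max_bot; apply: gr_rep_le.
by apply: (gr_classM ijn); rewrite ?gr_classD ?gr_repK ?gr_rep_le.
Qed.

Lemma gr_piece_mulC n i j (u : gr_piece i) (v : gr_piece j) :
  gr_piece_mul n u v = gr_piece_mul n v u.
Proof. by rewrite /gr_piece_mul mulrC. Qed.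

Lemma gr_piece_mul0l n i j (v : gr_piece j) : i + j = n ->
  gr_piece_mul n (0 : gr_piece i) v = 0.
Proof.
move=> ijn; apply: (addrI (gr_piece_mul n (0 : gr_piece i) v)).
by rewrite -gr_piece_mulDl // !addr0.
Qed.

Lemma gr_piece_mul0r n i j (u : gr_piece i) : i + j = n ->
  gr_piece_mul n u (0 : gr_piece j) = 0.
Proof. by move=> ijn; rewrite gr_piece_mulC gr_piece_mul0l // addrC. Qed.

Lemma gr_piece_mul_suml (I : Type) (s : seq I) n i j
    (F : I -> gr_piece i) (v : gr_piece j) : i + j = n ->
  gr_piece_mul n (\sum_(l <- s) F l) v = \sum_(l <- s) gr_piece_mul n (F l) v.
Proof.
move=> ijn; elim: s => [|l s IHs]; first by rewrite !big_nil gr_piece_mul0l.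
by rewrite !big_cons gr_piece_mulDl // IHs.
Qed.

Lemma gr_piece_mulA n i j l ij jl
    (u : gr_piece i) (v : gr_piece j) (w : gr_piece l) :
  i + j = ij -> j + l = jl -> ij + l = n ->
  gr_piece_mul n (gr_piece_mul ij u v) w =
  gr_piece_mul n u (gr_piece_mul jl v w).
Proof.
move=> eij ejl en; have en' : i + jl = n by rewrite -ejl addrA eij.
have uv := le_degM eij (gr_rep_le u) (gr_rep_le v).
have vw := le_degM ejl (gr_rep_le v) (gr_rep_le w).
rewrite {2}/gr_piece_mul {3}/gr_piece_mul.
rewrite -[in LHS](gr_repK w) -[in RHS](gr_repK u).
rewrite (gr_piece_mulE en uv (gr_rep_le w)).
by rewrite (gr_piece_mulE en' (gr_rep_le u) vw) mulrA.
Qed.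

(* Needed to rewrite indices in spite of the dependent types. *)
Lemma gr_piece_mul_eq n f g i i' j j' : i = i' -> j = j' ->
  gr_piece_mul n (f i) (g j) = gr_piece_mul n (f i') (g j').
Proof. by move=> -> ->. Qed.

Lemma big_supp (V : zmodType) (s t : seq G) (F : G -> V) :
  uniq s -> uniq t ->
  (forall i, i \notin s -> F i = 0) -> (forall i, i \notin t -> F i = 0) ->
  \sum_(i <- s) F i = \sum_(i <- t) F i.
Proof.
move=> us ut Fs Ft.
have E (r : seq G) : \sum_(i <- r) F i = \sum_(i <- r | F i != 0) F i.
  by rewrite [RHS]big_mkcond; apply: eq_bigr => i _; case: eqP.
rewrite E [RHS]E -big_filter -[RHS]big_filter; apply: perm_big.
apply: uniq_perm; rewrite ?filter_uniq // => i; rewrite !mem_filter.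
case: eqP => //= Fi; transitivity true; last symmetry.
- by apply/negP => /negP/Fs.
- by apply/negP => /negP/Ft.
Qed.

Lemma gr_mul_coefE f g n (s : seq G) : uniq s ->
  (forall i, i \notin s -> f i = 0) ->
  gr_mul_coef f g n = \sum_(i <- s) gr_piece_mul n (f i) (g (n - i)).
Proof.
have nE i : i + (n - i) = n by rewrite addrCA subrr addr0.
move=> us fs; apply: big_supp => //; first exact: gr_supp_uniq.
- by move=> i /gr_suppP->; rewrite gr_piece_mul0l.
- by move=> i /fs->; rewrite gr_piece_mul0l.
Qed.

Fact gr_mul_finite f g :
  exists s : seq G, forall n, n \notin s -> gr_mul_coef f g n = 0.
Proof.
exists [seq i + j | i <- gr_supp f, j <- gr_supp g] => n ns.
rewrite /gr_mul_coef big_seq big1 // => i fi.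
have nE : i + (n - i) = n by rewrite addrCA subrr addr0.
have -> : g (n - i) = 0.
  apply: gr_suppP; apply: contra ns => gi.
  by apply/allpairsP; exists (i, n - i); rewrite /= nE.
exact: gr_piece_mul0r.
Qed.
Definition gr_mul f g : gr := MkGr (gr_mul_finite f g).

(* The element of B_[n] given by x (deg x <= n), seen in Gr(B). *)
Definition gr_in_coef n x i : gr_piece i := gr_class i (if i == n then x else 0).
Fact gr_in_finite n x :
  exists s : seq G, forall i, i \notin s -> gr_in_coef n x i = 0.
Proof.
by exists [:: n] => i; rewrite inE /gr_in_coef => /negPf->; apply: gr_class0.
Qed.
Definition gr_in n x : gr := MkGr (gr_in_finite n x).

Definition gr_one : gr := gr_in 0 1.

Fact gr_mulC : commutative gr_mul.
Proof.
move=> f g; apply: grP => n /=.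
pose s := undup (gr_supp f ++ [seq n - j | j <- gr_supp g]).
have us : uniq s by apply: undup_uniq.
rewrite (@gr_mul_coefE f g n s) //; last first.
  by move=> i; rewrite mem_undup mem_cat negb_or => /andP[/gr_suppP].
have ns : uniq [seq n - i | i <- s].
  by rewrite map_inj_uniq // => i j /addrI/oppr_inj.
rewrite (@gr_mul_coefE g f n [seq n - i | i <- s]) //; last first.
  move=> j /negP jn; apply: gr_suppP; apply/negP => gj; apply: jn.
  apply/mapP; exists (n - j); last by rewrite subKr.
  rewrite mem_undup mem_cat; apply/orP; right.
  by apply/mapP; exists j.
rewrite big_map; apply: eq_bigr => i _.
by rewrite gr_piece_mulC; apply: gr_piece_mul_eq; rewrite ?subKr.
Qed.

Fact gr_mulDl : left_distributive gr_mul gr_add.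
Proof.
move=> f g h; apply: grP => n /=.
pose s := undup (gr_supp f ++ gr_supp g).
have us : uniq s by apply: undup_uniq.
have sf i : i \notin s -> f i = 0.
  by rewrite mem_undup mem_cat negb_or => /andP[/gr_suppP].
have sg i : i \notin s -> g i = 0.
  by rewrite mem_undup mem_cat negb_or => /andP[_ /gr_suppP].
rewrite (@gr_mul_coefE f h n s) // (@gr_mul_coefE g h n s) //.
rewrite (@gr_mul_coefE (gr_add f g) h n s) //=; last first.
  by move=> i si; rewrite sf // sg // addr0.
rewrite -big_split; apply: eq_bigr => i _ /=.
by rewrite gr_piece_mulDl // addrCA subrr addr0.
Qed.

Fact gr_mul1 : left_id gr_one gr_mul.
Proof.
move=> f; apply: grP => n /=.
rewrite (@gr_mul_coefE _ _ _ [:: 0]) //; last first.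
  by move=> i; rewrite inE /= /gr_in_coef => /negPf->; apply: gr_class0.
rewrite big_seq1 /= /gr_in_coef eqxx /gr_piece_mul.
have -> : gr_rep (f (n - 0)) = gr_rep (f n) by rewrite subr0.
rewrite -[RHS]gr_repK -[gr_rep (f n) in RHS]mul1r.
by apply: (gr_classM (add0r n)); rewrite ?gr_repK ?gr_rep_le ?deg1 /=.
Qed.

Fact gr_mulA : associative gr_mul.
Proof.
move=> f g h; apply: grP => n /=; symmetry.
pose s := undup [seq i + j | i <- gr_supp f, j <- gr_supp g].
have us : uniq s by apply: undup_uniq.
have nE m i : i + (m - i) = m by rewrite addrCA subrr addr0.
rewrite (@gr_mul_coefE _ h n s) //=; last first.
  move=> m ms; rewrite /gr_mul_coef big_seq big1 // => i fi.
  have -> : g (m - i) = 0.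
    apply: gr_suppP; apply: contra ms => gi; rewrite mem_undup.
    by apply/allpairsP; exists (i, m - i); rewrite /= nE.
  exact: gr_piece_mul0r.
transitivity (\sum_(i <- gr_supp f) \sum_(m <- s) gr_piece_mul n
    (gr_piece_mul m (f i) (g (m - i))) (h (n - m))).
  rewrite exchange_big; apply: eq_bigr => m _.
  by rewrite gr_piece_mul_suml.
rewrite /gr_mul_coef big_seq [RHS]big_seq; apply: eq_bigr => i fi.
pose t := [seq m - i | m <- s].
have ut : uniq t by rewrite map_inj_uniq // => m m' /addIr.
have tg j : j \notin t -> g j = 0.
  move=> jt; apply: gr_suppP; apply: contra jt => gj.
  apply/mapP; exists (i + j); last by rewrite addrC addKr.
  by rewrite mem_undup; apply/allpairsP; exists (i, j).
rewrite /= (@gr_mul_coefE g h _ t) // big_map.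
rewrite gr_piece_mulC gr_piece_mul_suml; last by rewrite addrC.
apply: eq_bigr => m _; rewrite [RHS]gr_piece_mulC.
rewrite (@gr_piece_mulA n i (m - i) (n - m) m (n - i)) //; last first.
  by rewrite addrC addrA subrK.
congr gr_piece_mul.
rewrite /gr_piece_mul; congr (gr_class _ (_ * gr_rep (h _))).
by rewrite opprB addrA subrK.
Qed.

Fact gr_one_neq0 : gr_one != 0 :> gr.
Proof.
apply/eqP => /(congr1 (fun f : gr => f 0)) /=; rewrite /gr_in_coef eqxx.
rewrite -(gr_class0 0) gr_classP ?subr0 ?deg1 ?deg0 //=.
by rewrite /lt_bot /= lexx.
Qed.

HB.instance Definition _ := GRing.Zmodule_isComNzRing.Build gr
  gr_mulA gr_mulC gr_mul1 gr_mulDl gr_one_neq0.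

End AssociatedGraded.

Section ScalarsOfGr.
Variables (k : fieldType) (B : comNzRingType) (iota : {rmorphism k -> B}).
Variables (G : toagType) (deg : degree_function B G).

Definition well_ordered_values : Prop :=
  forall S : G -> Prop,
    (forall i, S i -> exists2 x : B, x != 0 & deg x = Some i) ->
    (exists i, S i) -> exists2 m, S m & forall i, S i -> m <= i.

Hypothesis wo : well_ordered_values.

Lemma well_ordered_deg_ge0 x i : deg x = Some i -> 0 <= i.
Proof.
move=> xi; have degX n : deg (x ^+ n) = Some (i *+ n).
  by elim: n => [|n IHn]; rewrite ?deg1 // exprS degM xi IHn mulrS.
case: (wo (S := fun j => exists n, j = i *+ n)).
- move=> _ [n ->]; exists (x ^+ n) => //.
  by apply/eqP => /(deg_eq_bot deg); rewrite degX.
- by exists 0, 0%N.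
move=> _ [n ->] /(_ (i *+ n.+1)) min.
have /(toag_leD2r (- (i *+ n))) : i *+ n <= i *+ n.+1 by apply: min; exists n.+1.
by rewrite subrr mulrS addrK.
Qed.

Lemma well_ordered_deg_scalar c : c != 0 -> deg (iota c) = Some 0.
Proof.
move=> c0; have := deg1 deg; rewrite -(rmorph1 iota) -(divff c0) rmorphM degM.
case ec: (deg (iota c)) => [i|//]; case ed: (deg (iota c^-1)) => [j|//] /= [ij].
have i0 := well_ordered_deg_ge0 ec; have j0 := well_ordered_deg_ge0 ed.
congr Some; apply/eqP; rewrite eq_le i0 andbT.
by have := toag_leD2r i _ _ j0; rewrite add0r addrC ij.
Qed.

Lemma well_ordered_scalar_le0 c : le_bot (deg (iota c)) (Some 0).
Proof.
have [->|/well_ordered_deg_scalar->] := eqVneq c 0; last by rewrite /=.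
by rewrite rmorph0 deg0.
Qed.

(* k -> B_{<= 0} -> B_[0] -> Gr(B) *)
Definition gr_scalar of well_ordered_values : k -> gr deg :=
  fun c => gr_in deg 0 (iota c).

Fact gr_scalar_is_zmod_morphism : zmod_morphism (gr_scalar wo).
Proof.
have add : {morph gr_scalar wo : c d / c + d}.
  move=> c d; apply: grP => i /=; rewrite /gr_in_coef.
  case: eqP => [->|_]; last by rewrite gr_class0 addr0.
  by rewrite rmorphD gr_classD ?well_ordered_scalar_le0.
move=> c d; apply: (addIr (gr_scalar wo d)).
by rewrite -add !subrK.
Qed.

Fact gr_scalar_is_monoid_morphism : monoid_morphism (gr_scalar wo).
Proof.
split; first by rewrite /gr_scalar rmorph1.
move=> c d; apply: grP => n /=.
rewrite (@gr_mul_coefE _ _ _ _ _ _ [:: 0]) //; last first.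
  by move=> i; rewrite inE /= /gr_in_coef => /negPf->; apply: gr_class0.
rewrite big_seq1 /= /gr_in_coef eqxx subr0.
case: eqP => [->|_]; last by rewrite gr_class0 gr_piece_mul0r ?add0r.
by rewrite rmorphM gr_piece_mulE ?add0r ?well_ordered_scalar_le0.
Qed.

HB.instance Definition _ :=
  GRing.isZmodMorphism.Build k (gr deg) (gr_scalar wo)
    gr_scalar_is_zmod_morphism.
HB.instance Definition _ :=
  GRing.isMonoidMorphism.Build k (gr deg) (gr_scalar wo)
    gr_scalar_is_monoid_morphism.

End ScalarsOfGr.

(* A field extension L/F is given by a field L and a subfield F of L. *)
Section FieldExtensions.
Variable L : fieldType.
Implicit Types (F S : L -> Prop) (y : L).

(* The subfield F(S) of L. *)
Definition adjoin F S : L -> Prop := fun y =>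
  forall K : {pred L}, divring_closed K ->
    (forall z, F z -> z \in K) -> (forall z, S z -> z \in K) -> y \in K.

Definition algebraic_over F y : Prop :=
  exists p : {poly L}, [/\ p != 0, forall i, F p`_i & root p y].

Definition algebraically_independent F (n : nat) (x : 'I_n -> L) : Prop :=
  forall p : {mpoly L[n]}, (forall m, F p@_m) -> p.@[x] = 0 -> p = 0.

Definition transcendence_basis F (n : nat) (x : 'I_n -> L) : Prop :=
  algebraically_independent F x /\
  forall y, algebraic_over (adjoin F (fun z => exists i, z = x i)) y.

Definition has_trdeg F (n : nat) : Prop :=
  exists x : 'I_n -> L, transcendence_basis F x.

Definition finite_trdeg F : Prop := exists n, has_trdeg F n.

Definition fg_field_extension F : Prop :=
  exists s : seq L, forall y, adjoin F (fun z => z \in s) y.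

Definition one_dim_function_field F : Prop :=
  fg_field_extension F /\ has_trdeg F 1.

End FieldExtensions.

Section FractionFields.
Variable B : idomainType.

(* Frac(A) inside Frac(B), for a subring A of B. *)
Definition frac_subring (A : B -> Prop) : {fraction B} -> Prop := fun z =>
  exists a b, [/\ A a, A b, b != 0 & z = tofrac a / tofrac b].

Definition finite_trdeg_domain (k : fieldType) (iota : {rmorphism k -> B}) :=
  finite_trdeg (fun z : {fraction B} => exists c, z = tofrac (iota c)).

End FractionFields.

Definition values_in_nat (B : comNzRingType) (deg : B -> option int) : Prop :=
  forall x, x != 0 -> exists n : nat, deg x = Some n%:Z.

Definition is_deg_of_lnd (B : idomainType) (Delta : B -> B)
    (deg : B -> option int) : Prop :=
  deg 0 = None /\
  forall x, x != 0 -> exists n : nat,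
    [/\ iter n Delta x != 0,
        forall m : nat, iter m Delta x != 0 -> (m <= n)%N &
        deg x = Some n%:Z].

(* Main.v *)
(* A derivation D is bounded as soon as its shift is bounded on enough elements.
   (a), (b): the elements whose components b of degree i satisfy
   deg (D b) <= i + M form a subalgebra of B, resp. of Gr(B), so it suffices that
   M be the largest shift on finitely many generators.
   (c), (d): let A be the subring of elements of degree at most 0.  The elements a
   of A with deg (D a) <= M form a subring which is algebraically closed in A;
   as the transcendence degree is finite, these subrings stabilize, so D is bounded
   on A.  Let x have positive degree.  It remains to see that, for suitable
   y_1, ..., y_m, every z of degree d satisfies an equation
   a z = \sum_i c_i y_i + x w + r with 0 <> a and c_i in A, all terms of degree at
   most d and deg r < d: induction on d then bounds D.  In (d), x is a local slice
   and m = 1.  In (c), take for (y_i) a maximal family whose leading forms are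
   independent over A modulo x: such a family is linearly independent over A[x],
   and Frac(B) is finite over Frac(A[x]). *)
Require Import Defs.
From HB Require Import structures.
From mathcomp Require Import all_boot all_order all_algebra.
From mathcomp Require Import fraction separable boolp zify ring.

Set Implicit Arguments.
Unset Strict Implicit.
Unset Printing Implicit Defensive.

Import Order.TTheory GRing.Theory Num.Theory.
Local Open Scope ring_scope.

(** * Algebraic dependence *)

Section SubfieldType.
Variables (L : fieldType) (F : divringClosed L).

Definition subfield : Type := {x : L | x \in F}.
HB.instance Definition _ := SubChoice.on subfield.
HB.instance Definition _ := [SubChoice_isSubIntegralDomain of subfield by <:].
HB.instance Definition _ := [SubIntegralDomain_isSubField of subfield by <:].

Definition subfield_val : subfield -> L := val.
HB.instance Definition _ := GRing.RMorphism.copy subfield_val (val : subfield -> L).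

Lemma subfield_valP (a : subfield) : subfield_val a \in F.
Proof. exact: valP. Qed.

Lemma polyOver_subfield (p : {poly L}) :
  (forall i, p`_i \in F) -> exists q : {poly subfield}, p = map_poly subfield_val q.
Proof.
move=> pF; exists (\poly_(i < size p) (insubd (0 : subfield) p`_i)).
apply/polyP=> i; rewrite coef_map coef_poly /=.
case: ltnP => ip; first by rewrite /subfield_val insubdK.
by rewrite nth_default // rmorph0.
Qed.

(** Turns algebraicity over a subset of [L] into algebraicity along a morphism of field types, where
    closure under the field operations and the primitive element theorem are available. *)
Lemma algebraic_overP (y : L) :
  algebraic_over (fun z => z \in F) y <-> algebraicOver subfield_val y.
Proof.
split=> [[p [p0 /polyOver_subfield[q pq] py]]|[q q0 qy]].
  by exists q; rewrite -?pq //; apply: contra_neq p0; rewrite pq => ->; rewrite rmorph0.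
exists (map_poly subfield_val q); split=> //; first by rewrite map_poly_eq0.
by move=> i; rewrite coef_map /= subfield_valP.
Qed.

End SubfieldType.

Arguments subfield_val {L F}.

Lemma subring_closed0 (R : nzRingType) (A : {pred R}) : subring_closed A -> 0 \in A.
Proof. by case=> A1 AB _; rewrite -(subrr 1) AB. Qed.

(** The subring $A[u]$, when [A] is a subring. *)
Definition horner_image (R : comNzRingType) (A : {pred R}) (u : R) : {pred R} :=
  fun z => `[< exists2 p : {poly R}, forall i, p`_i \in A & z = p.[u] >].

Lemma horner_imageP (R : comNzRingType) (A : {pred R}) u z :
  reflect (exists2 p : {poly R}, forall i, p`_i \in A & z = p.[u])
          (z \in horner_image A u).
Proof. exact: asboolP. Qed.

Lemma horner_image_closed (R : comNzRingType) (A : {pred R}) u : subring_closed A ->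
  subring_closed (horner_image A u).
Proof.
move=> Ar; pose A' : subringClosed R := HB.pack A (GRing.isSubringClosed.Build R A Ar).
have AP (p : {poly R}) : (forall i, p`_i \in A) <-> p \is a polyOver A'.
  by split=> Ap; [apply/polyOverP | move=> i; apply: (polyOverP Ap)].
split=> [|_ _ /horner_imageP[p /AP Ap ->] /horner_imageP[q /AP Aq ->]
         |_ _ /horner_imageP[p /AP Ap ->] /horner_imageP[q /AP Aq ->]];
  apply/horner_imageP.
- by exists 1; rewrite ?hornerC //; apply/AP; rewrite rpred1.
- by exists (p - q); rewrite ?hornerD ?hornerN //; apply/AP; rewrite rpredB.
- by exists (p * q); rewrite ?hornerM //; apply/AP; rewrite rpredM.
Qed.

Lemma sub_horner_image (R : comNzRingType) (A : {pred R}) u : subring_closed A ->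
  {subset A <= horner_image A u}.
Proof.
move=> Ar a Aa; apply/horner_imageP; exists a%:P; rewrite ?hornerC // => i.
by rewrite coefC; case: eqP => // _; apply: subring_closed0.
Qed.

Lemma mem_horner_image (R : comNzRingType) (A : {pred R}) u : subring_closed A ->
  u \in horner_image A u.
Proof.
move=> Ar; apply/horner_imageP; exists 'X; rewrite ?hornerX // => i.
by rewrite coefX; case: eqP => _; [case: Ar | apply: subring_closed0].
Qed.

(** * Fractions and algebraic elements inside a fixed field *)

Section AlgebraicClosure.
Variable L : fieldType.
Implicit Types (R F : {pred L}) (S T k : L -> Prop) (u x y z : L).

Definition frac_pred R : {pred L} :=
  fun z => `[< exists a b, [/\ a \in R, b \in R, b != 0 & z = a / b] >].

Lemma frac_predP R z :
  reflect (exists a b, [/\ a \in R, b \in R, b != 0 & z = a / b])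
          (z \in frac_pred R).
Proof. exact: asboolP. Qed.

Lemma frac_pred_closed R : subring_closed R -> divring_closed (frac_pred R).
Proof.
move=> Rr; have [R1 RB RM] := Rr; have R0 := subring_closed0 Rr.
split=> [|_ _ /frac_predP[a [b [Ra Rb b0 ->]]] /frac_predP[c [d [Rc Rd d0 ->]]]|
         _ _ /frac_predP[a [b [Ra Rb b0 ->]]] /frac_predP[c [d [Rc Rd d0 ->]]]].
- by apply/frac_predP; exists 1, 1; rewrite oner_eq0 divr1.
- apply/frac_predP; exists (a * d - c * b), (b * d).
  by rewrite RB ?RM // mulf_eq0 negb_or b0 d0 -mulNr addf_div ?mulNr.
- apply/frac_predP; have [->|c0] := eqVneq c 0.
    by exists 0, 1; rewrite oner_eq0 !mul0r invr0 mulr0.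
  exists (a * d), (b * c); rewrite !RM // mulf_eq0 negb_or b0 c0.
  by rewrite invf_div mulf_div.
Qed.

Lemma sub_frac_pred R : subring_closed R -> {subset R <= frac_pred R}.
Proof.
by case=> R1 _ _ a Ra; apply/frac_predP; exists a, 1; rewrite oner_eq0 divr1.
Qed.

Lemma common_denominator R (s : seq L) : subring_closed R ->
  {subset s <= frac_pred R} ->
  exists b, [/\ b \in R, b != 0 & forall z, z \in s -> b * z \in R].
Proof.
case=> R1 RB RM; elim: s => [_|x s IHs sub]; first by exists 1; rewrite oner_eq0.
have [|b [Rb b0 bs]] := IHs; first by move=> z zs; rewrite sub // inE zs orbT.
have /frac_predP[a [c [Ra Rc c0 def_x]]] := sub x (mem_head _ _).
exists (c * b); rewrite RM // mulf_eq0 negb_or c0 b0; split=> // z.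
rewrite inE => /predU1P[->|/bs zs]; last by rewrite -mulrA RM.
by rewrite def_x mulrAC mulrCA divff // mulr1 mulrC RM.
Qed.

(** Multiplying by a common denominator brings the coefficients into [R] and keeps the root. *)
Lemma algebraic_over_frac_pred R y : subring_closed R ->
  algebraic_over (fun z => z \in frac_pred R) y ->
  algebraic_over (fun z => z \in R) y.
Proof.
move=> Rr [p [p0 pR py]]; have R0 := subring_closed0 Rr.
have [|b [Rb b0 bp]] := @common_denominator R p Rr.
  by move=> _ /(nthP 0)[i _ <-].
exists (b *: p); split; first by rewrite scaler_eq0 negb_or b0.
  move=> i; rewrite coefZ; have [ip|ip] := ltnP i (size p).
    by rewrite bp // mem_nth.
  by rewrite nth_default // mulr0.
by rewrite rootE hornerZ (rootP py) mulr0.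
Qed.

Lemma algebraic_over_sub S T y :
  (forall z, S z -> T z) -> algebraic_over S y -> algebraic_over T y.
Proof. by move=> ST [p [p0 pS py]]; exists p; split=> // i; apply/ST. Qed.

Lemma algebraic_over_mem F y : divring_closed F -> y \in F ->
  algebraic_over (fun z => z \in F) y.
Proof.
move=> Ff Fy; have [F1 FB _] := Ff; have F0 := subring_closed0 Ff.
exists ('X - y%:P); rewrite polyXsubC_eq0 root_XsubC; split=> // -[|[|i]].
- by rewrite coefB coefX coefC FB.
- by rewrite coefB coefX coefC subr0.
- by rewrite coefB coefX coefC subr0.
Qed.

Definition algebraic_pred F : {pred L} :=
  fun y => `[< algebraic_over (fun z => z \in F) y >].

Lemma algebraic_predP F y :
  reflect (algebraic_over (fun z => z \in F) y) (y \in algebraic_pred F).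
Proof. exact: asboolP. Qed.

Lemma algebraic_pred_closed F : divring_closed F -> divring_closed (algebraic_pred F).
Proof.
move=> Ff; pose F' : divringClosed L := HB.pack F (GRing.isDivringClosed.Build L F Ff).
have E y : algebraic_over (fun z => z \in F) y <-> algebraicOver (@subfield_val L F') y.
  exact: (@algebraic_overP L F').
split=> [|x y /algebraic_predP/E xF /algebraic_predP/E yF
         |x y /algebraic_predP/E xF /algebraic_predP/E yF]; apply/algebraic_predP/E.
- exact: algebraic1.
- exact: algebraic_sub.
- exact: algebraic_div.
Qed.

(** Over a field, algebraic means integral, and integrality is transitive: divided by its leading
    coefficient, [p] is monic with coefficients integral over [F]. *)
Lemma algebraic_over_trans F S y : divring_closed F ->
  (forall z, S z -> algebraic_over (fun z => z \in F) z) ->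
  algebraic_over S y -> algebraic_over (fun z => z \in F) y.
Proof.
move=> Ff SF [p [p0 pS py]].
pose F' : divringClosed L := HB.pack F (GRing.isDivringClosed.Build L F Ff).
have E z : algebraic_over (fun z => z \in F) z <-> algebraicOver (@subfield_val L F') z.
  exact: (@algebraic_overP L F').
apply/E/integral_algebraic.
have lp0 : (lead_coef p)^-1 != 0 by rewrite invr_eq0 lead_coef_eq0.
apply: (@integral_root_monic _ _ _ _ ((lead_coef p)^-1 *: p)).
- by rewrite monicE lead_coefZ mulVf // lead_coef_eq0.
- by rewrite rootZ.
move=> _ /(nthP 0)[i _ <-]; rewrite coefZ mulrC; apply/integral_algebraic.
by apply: algebraic_div; apply/E/SF; [apply: pS | rewrite lead_coefE; apply: pS].
Qed.

Definition adjoin_pred k S : {pred L} := fun y => `[< adjoin k S y >].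

Lemma adjoin_predP k S y : reflect (adjoin k S y) (y \in adjoin_pred k S).
Proof. exact: asboolP. Qed.

Lemma adjoin_closed k S : divring_closed (adjoin_pred k S).
Proof.
split=> [|x y /asboolP Ax /asboolP Ay|x y /asboolP Ax /asboolP Ay];
  apply/asboolP => K Kf KF KS; have [K1 KB KM] := Kf => //.
- by rewrite KB ?Ax ?Ay.
- by rewrite KM ?Ax ?Ay.
Qed.

Lemma adjoin_base k S y : k y -> adjoin k S y.
Proof. by move=> Fy K _ KF _; apply: KF. Qed.

Lemma adjoin_gen k S y : S y -> adjoin k S y.
Proof. by move=> Sy K _ _; apply. Qed.

(** * Algebraic closure as a matroid *)

Section Matroid.
Variable k : L -> Prop.

Definition alg_closure S y : Prop := algebraic_over (adjoin k S) y.

Lemma alg_closureE S y :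
  alg_closure S y <-> algebraic_over (fun z => z \in adjoin_pred k S) y.
Proof. by split; apply: algebraic_over_sub => z /adjoin_predP. Qed.

Lemma alg_closure_mem S y : S y -> alg_closure S y.
Proof.
move=> Sy; apply/alg_closureE/algebraic_over_mem; first exact: adjoin_closed.
exact/asboolP/adjoin_gen.
Qed.

(** The elements algebraic over $k(T)$ form a field containing [k] and [S], hence $k(S)$;
    transitivity concludes. *)
Lemma alg_closure_sub S T : (forall z, S z -> alg_closure T z) ->
  forall y, alg_closure S y -> alg_closure T y.
Proof.
move=> ST y Sy; apply/alg_closureE.
apply: (algebraic_over_trans (adjoin_closed k T)) Sy => z Sz.
apply/algebraic_predP/Sz; first exact/algebraic_pred_closed/adjoin_closed.
- move=> w kw; apply/algebraic_predP/algebraic_over_mem; first exact: adjoin_closed.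
  exact/adjoin_predP/adjoin_base.
- by move=> w /ST/alg_closureE ?; apply/algebraic_predP.
Qed.

Lemma alg_closure_mono S T y : (forall z, S z -> T z) -> alg_closure S y -> alg_closure T y.
Proof. by move=> ST; apply: alg_closure_sub => z /ST/alg_closure_mem. Qed.

Definition add_elt S u : L -> Prop := fun z => z = u \/ S z.

(** With $E = k(S)$, clearing denominators turns the algebraicity of [x] over $E(u)$ into a
    polynomial relation over [E] between [u] and [x]. Read as an equation for [u] over $E(x)$, it is
    non-trivial because [x] is transcendental over [E]. *)
Lemma alg_closure_exchange S u x : alg_closure (add_elt S u) x -> ~ alg_closure S x ->
  alg_closure (add_elt S x) u.
Proof.
set E := adjoin_pred k S => Sux nSx.
have Ef : divring_closed E := adjoin_closed k S.
have Er : subring_closed E := Ef; have E0 := subring_closed0 Er.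
have Rr := horner_image_closed u Er; set R := horner_image E u in Rr.
have /(algebraic_over_frac_pred Rr)[p [p0 pR px]] :
    algebraic_over (fun z => z \in frac_pred R) x.
  apply: algebraic_over_sub Sux => z; apply; first exact: frac_pred_closed.
    by move=> w kw; apply/(sub_frac_pred Rr)/(sub_horner_image _ Er)/adjoin_predP/adjoin_base.
  move=> w [->|Sw]; apply/(sub_frac_pred Rr); first exact: mem_horner_image.
  exact/(sub_horner_image _ Er)/adjoin_predP/adjoin_gen.
have /choice[P PP] i : exists q : {poly L}, (forall j, q`_j \in E) /\ p`_i = q.[u].
  by have /horner_imageP[q] := pR i; exists q.
(* p(x) = \sum_i P_i(u) x^i, read as a polynomial in u. *)
pose q := \sum_(i < size p) x ^+ i *: P i.
pose A' : divringClosed L := HB.pack (adjoin_pred k (add_elt S x))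
  (GRing.isDivringClosed.Build L _ (adjoin_closed k (add_elt S x))).
exists q; split.
- have /negP lp := p0; apply/negP => /eqP q0; apply: lp.
  rewrite -lead_coef_eq0 lead_coefE; have [_ ->] := PP (size p).-1.
  suff -> : P (size p).-1 = 0 by rewrite horner0.
  (* If the last [P i] had a non-zero coefficient of index [j], the coefficients of index [j] of all
     the [P i] would form a non-zero polynomial over [E], killing [x] because [q] is 0. *)
  apply/polyP => j; rewrite coef0; apply: contra_notP nSx => /eqP Pj.
  apply/alg_closureE; exists (\poly_(i < size p) (P i)`_j); split.
  + apply: contra_neqN Pj => /eqP/(congr1 (fun r : {poly L} => r`_(size p).-1)).
    by rewrite coef_poly coef0 prednK ?leqnn ?lt0n ?size_poly_eq0.
  + by move=> i; rewrite coef_poly; case: ifP => // _; apply: (PP i).1.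
  rewrite rootE horner_poly; move/(congr1 (fun r : {poly L} => r`_j)): q0.
  rewrite coef0 coef_sum => q0j; apply/eqP; rewrite -[RHS]q0j.
  by apply: eq_bigr => i _; rewrite coefZ mulrC.
- move=> i; apply/adjoin_predP; suff: q`_i \in A' by [].
  rewrite coef_sum rpred_sum // => j _.
  rewrite coefZ rpredM ?rpredX //; apply/adjoin_predP; first by apply: adjoin_gen; left.
  have /adjoin_predP := (PP j).1 i => Pij K Kf KK KS; apply: Pij => // w Sw.
  by apply: KS; right.
apply/rootP; rewrite horner_sum -[RHS](rootP px) -[p in RHS]coefK horner_poly.
by under eq_bigr => i _ do rewrite hornerZ mulrC -(PP i).2.
Qed.

Definition adds S (s : seq L) : L -> Prop := fun z => z \in s \/ S z.

(** A sequential form of algebraic independence, which needs no polynomials in several variables and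
    lets a family grow by one element at a time. *)
Fixpoint independent_chain S (s : seq L) : Prop :=
  if s is a :: s' then ~ alg_closure S a /\ independent_chain (add_elt S a) s'
  else True.

Lemma independent_chain_rcons S s a : independent_chain S s ->
  ~ alg_closure (adds S s) a -> independent_chain S (rcons s a).
Proof.
elim: s S => [|b s IHs] S /= => [_ Sa|[Sb bs] Sa].
  by split=> //; apply: contra_not Sa; apply: alg_closure_mono => z Sz; right.
split=> //; apply: IHs => //; apply: contra_not Sa; apply: alg_closure_mono => z.
by rewrite /adds /add_elt inE => -[->|[->|Sz]]; rewrite ?eqxx ?orbT; auto.
Qed.

(** Steinitz replacement. The entry dropped is the first [u] such that [a] is not algebraic over [S]
    and the entries after [u]; by exchange, [u] is recovered from [a] and these entries. *)
Lemma alg_closure_replace S a s : ~ alg_closure S a -> alg_closure (adds S s) a ->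
  exists2 t, size s = (size t).+1 &
    forall y, alg_closure (adds S s) y -> alg_closure (adds (add_elt S a) t) y.
Proof.
move=> Sa; elim: s => [|u s IHs] sa.
  by case: Sa; apply: alg_closure_mono sa => z [].
have E z : adds S (u :: s) z <-> add_elt (adds S s) u z.
  by rewrite /adds /add_elt inE; split=> [[/predU1P[]|]|[->|[]]]; rewrite ?eqxx; auto;
     move=> ->; rewrite orbT; left.
have [sa'|sa'] := pselect (alg_closure (adds S s) a).
  have [t st tP] := IHs sa'; exists (u :: t); rewrite /= ?st // => y.
  apply: alg_closure_sub => z /E[->|/alg_closure_mem/tP].
    by apply: alg_closure_mem; left; rewrite mem_head.
  by apply: alg_closure_mono => w [wt|]; [left; rewrite inE wt orbT|right].
exists s => // y; apply: alg_closure_sub => z /E[->|[zs|Sz]].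
- apply: (@alg_closure_mono (add_elt (adds S s) a)); last first.
    by apply: alg_closure_exchange sa'; apply: alg_closure_mono sa => w /E.
  by move=> w [->|[ws|Sw]]; [right; left|left|right; right].
- by apply: alg_closure_mem; left.
- by apply: alg_closure_mem; right; right.
Qed.

(** Each entry of [t] in turn takes the place of one entry of the generating list [s]. *)
Lemma independent_chain_size S s t : (forall y, alg_closure (adds S s) y) ->
  independent_chain S t -> (size t <= size s)%N.
Proof.
elim: t S s => [|a t IHt] S s sP //= [Sa at_].
have [s' -> s'P] := alg_closure_replace Sa (sP a).
by rewrite ltnS; apply: IHt at_ => y; apply/s'P/sP.
Qed.

End Matroid.

End AlgebraicClosure.

(** * Linear dependence in finitely generated algebraic extensions *)

Section FiniteDimension.
Variables (L : fieldType) (char0 : [pchar L] =i pred0).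

Lemma primitive_generator (F : divringClosed L) (s : seq L) :
  (forall y, y \in s -> algebraicOver (@subfield_val _ F) y) ->
  exists2 z, algebraicOver (@subfield_val _ F) z &
    forall y, y \in s -> exists p : {poly subfield F}, (map_poly subfield_val p).[z] = y.
Proof.
have charF : [pchar subfield F] =i pred0.
  by move=> p; rewrite -(fmorph_pchar (@subfield_val _ F)) char0.
elim: s => [_|x s IHs algs]; first by exists 0; [apply: algebraic0 |].
have [z [q q0 qz] zP] : exists2 z, algebraicOver (@subfield_val _ F) z &
    forall y, y \in s -> exists p : {poly subfield F}, (map_poly subfield_val p).[z] = y.
  by apply: IHs => y ys; apply: algs; rewrite inE ys orbT.
have [p p0 px] := algs x (mem_head _ _).
have [n [[p1 p1P] [p2 p2P]]] := pchar0_PET p0 px q0 qz charF.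
exists (z *+ n - x).
  have algx : algebraicOver (@subfield_val _ F) x by exists p.
  apply: algebraic_sub => //; rewrite -mulr_natl.
  apply: algebraic_mul; last by exists q.
  by rewrite -(rmorph_nat (@subfield_val _ F)); apply: algebraic_id.
move=> y; rewrite inE => /predU1P[->|/zP[r <-]]; first by exists p1.
by exists (r \Po p2); rewrite map_comp_poly horner_comp p2P.
Qed.

(** Finite dimension of [L] over [F], expressed by the dependence of any [d] elements. Here [d] is
    one more than the degree of a polynomial [p] killing a primitive element [z]. *)
Lemma finite_dependence (F : divringClosed L) (s : seq L) :
  (forall y, y \in s -> algebraic_over (fun z => z \in F) y) ->
  (forall y, adjoin (fun z => z \in F) (fun z => z \in s) y) ->
  exists d, forall v : nat -> L, exists c : nat -> L,
    [/\ forall i, c i \in F, exists2 i, (i < d)%N & c i != 0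
      & \sum_(i < d) c i * v i = 0].
Proof.
move=> algs gens.
have [y ys|z [p p0 pz] zP] := @primitive_generator F s.
  exact/algebraic_overP/algs.
exists (size p) => v.
pose R : {pred L} := fun y =>
  `[< exists q : {poly subfield F}, (map_poly subfield_val q).[z] = y >].
have Rr : subring_closed R.
  split=> [|_ _ /asboolP[f <-] /asboolP[g <-]|_ _ /asboolP[f <-] /asboolP[g <-]];
    apply/asboolP.
  - by exists 1; rewrite rmorph1 hornerC.
  - by exists (f - g); rewrite rmorphB hornerD hornerN.
  - by exists (f * g); rewrite rmorphM hornerM.
(* [R] is $F[z]$, and its fractions exhaust [L]; a common denominator [b] thus brings all the [v i]
   into [R]. *)
have fracR y : y \in frac_pred R.
  apply: gens; first exact: frac_pred_closed.
    move=> w wF; apply/(sub_frac_pred Rr)/asboolP.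
    by exists (exist _ w wF : subfield F)%:P; rewrite map_polyC hornerC.
  by move=> w /zP ws; apply/(sub_frac_pred Rr)/asboolP.
have [y _|b [_ b0 bv]] := @common_denominator _ R (mkseq v (size p)) Rr.
  exact: fracR.
have /choice[g gP] (i : nat) : exists g : {poly subfield F},
    (i < size p)%N -> (map_poly subfield_val g).[z] = b * v i.
  have [ip|_] := ltnP i (size p); last by exists 0.
  have /asboolP[g gE] : b * v i \in R by apply: bv; apply/mapP; exists i; rewrite ?mem_iota.
  by exists g.
pose M := \matrix_(i < size p, j < (size p).-1) (g i %% p)`_j.
have sp : (0 < size p)%N by rewrite lt0n size_poly_eq0.
(* The rows of [M] are the remainders modulo [p] of polynomials representing the [b * v i]. There is
   one more row than there are columns, so some non-zero [w] combines them to 0. *)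
have /rowV0Pn[w /sub_kermxP wM w0] : kermx M != 0.
  rewrite -mxrank_eq0 mxrank_ker subn_eq0 -ltnNge.
  by apply: leq_ltn_trans (rank_leq_col _) _; rewrite ltn_predL.
pose c (i : nat) : subfield F := if insub i is Some j then w 0 j else 0.
have cE (i : 'I_(size p)) : c i = w 0 i by rewrite /c valK.
exists (fun i => subfield_val (c i)); split.
- by move=> i; apply: subfield_valP.
- have [j wj] : exists j, w 0 j != 0.
    apply: contrapT => nw; case/negP: w0; apply/eqP/rowP => j; rewrite mxE.
    by apply: contra_notP nw => /eqP wj; exists j.
  by exists j => //; rewrite fmorph_eq0 cE.
apply: (mulfI b0); rewrite mulr0 mulr_sumr.
transitivity (map_poly subfield_val (\sum_(i < size p) c i *: (g i %% p))).[z].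
  rewrite rmorph_sum horner_sum; apply: eq_bigr => i _ /=.
  rewrite mulrCA -gP // map_polyZ hornerZ; congr (_ * _).
  rewrite [in LHS](divp_eq (g i) p) rmorphD rmorphM hornerD hornerM.
  by rewrite (rootP pz) mulr0 add0r.
suff -> : \sum_(i < size p) c i *: (g i %% p) = 0 by rewrite rmorph0 horner0.
apply/polyP=> j; rewrite coef0 coef_sum; have [jp|jp] := ltnP j (size p).-1.
  have := congr1 (fun A : 'rV_(size p).-1 => A 0 (Ordinal jp)) wM.
  rewrite !mxE => wMj; rewrite -[RHS]wMj.
  by apply: eq_bigr => i _; rewrite coefZ cE mxE.
rewrite big1 // => i _; rewrite coefZ nth_default ?mulr0 //.
by apply: leq_trans jp; rewrite -ltnS prednK // ltn_modp.
Qed.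

End FiniteDimension.

(** * Derivations whose shift is bounded on generators *)

Section BottomArithmetic.
Variable G : toagType.
Implicit Types (a b c : option G).

Lemma add_botC a b : add_bot a b = add_bot b a.
Proof. by case: a b => [i|] [j|] //=; rewrite addrC. Qed.

Lemma add_botA a b c : add_bot a (add_bot b c) = add_bot (add_bot a b) c.
Proof. by case: a b c => [i|] [j|] [l|] //=; rewrite addrA. Qed.

Lemma le_sub_bot a i c :
  le_bot (sub_bot a (Some i)) c = le_bot a (add_bot (Some i) c).
Proof.
case: a c => [j|] [l|] //=; apply/idP/idP => [/(toag_leD2r i)|/(toag_leD2r (- i))].
  by rewrite subrK addrC.
by rewrite addrAC subrr add0r.
Qed.

Lemma le_max_botl a b : le_bot a (max_bot a b).
Proof.
rewrite /max_bot; case: ifP => // _; exact: le_bot_refl.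
Qed.

Lemma le_max_botr a b : le_bot b (max_bot a b).
Proof.
rewrite /max_bot; case: ifP => [_|]; first exact: le_bot_refl.
by have := le_bot_total a b => /orP[->|].
Qed.

Lemma le_add_bot2l a b c : le_bot b c -> le_bot (add_bot a b) (add_bot a c).
Proof. exact: le_add_bot (le_bot_refl a). Qed.

Lemma le_add_bot2r a b c : le_bot b c -> le_bot (add_bot b a) (add_bot c a).
Proof. by move=> bc; apply: le_add_bot bc (le_bot_refl a). Qed.

End BottomArithmetic.

Section DegreeOfSums.
Variables (B : comNzRingType) (G : toagType) (deg : degree_function B G).
Implicit Types (x y : B) (a : option G).

Lemma deg_leD x y a : le_bot (deg x) a -> le_bot (deg y) a -> le_bot (deg (x + y)) a.
Proof. by move=> xa ya; apply: le_bot_trans (degD _ _ _) (le_max_bot xa ya). Qed.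

Lemma deg_leB x y a : le_bot (deg x) a -> le_bot (deg y) a -> le_bot (deg (x - y)) a.
Proof. by move=> xa ya; apply: deg_leD; rewrite ?degN. Qed.

Lemma deg_le_sum (I : eqType) (s : seq I) (F : I -> B) a :
  (forall i, i \in s -> le_bot (deg (F i)) a) -> le_bot (deg (\sum_(i <- s) F i)) a.
Proof.
move=> leF; rewrite big_seq; elim/big_rec: _ => [|i x si xa]; first by rewrite deg0.
by apply: deg_leD => //; apply: leF.
Qed.

End DegreeOfSums.

Section DerivationTheory.
Variables (B : idomainType) (D : B -> B).
Hypothesis derD : derivation D.

Lemma derivationD x y : D (x + y) = D x + D y. Proof. exact: derD.1. Qed.
Lemma derivationM x y : D (x * y) = D x * y + x * D y. Proof. exact: derD.2. Qed.

Lemma derivation0 : D 0 = 0.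
Proof. by apply: (addrI (D 0)); rewrite -derivationD !addr0. Qed.

Lemma derivationN x : D (- x) = - D x.
Proof. by apply: (addrI (D x)); rewrite -derivationD !subrr derivation0. Qed.

Lemma derivationB x y : D (x - y) = D x - D y.
Proof. by rewrite derivationD derivationN. Qed.

Lemma derivation1 : D 1 = 0.
Proof.
by apply: (addrI (D 1)); rewrite addr0 -{3}(mulr1 1) derivationM mulr1 mul1r.
Qed.

Lemma derivation_sum (I : Type) (s : seq I) (F : I -> B) :
  D (\sum_(i <- s) F i) = \sum_(i <- s) D (F i).
Proof. by apply: big_morph; [apply: derivationD | apply: derivation0]. Qed.

End DerivationTheory.

Section ShiftBounds.
Variables (B : idomainType) (G : toagType) (deg : degree_function B G).
Variable D : B -> B.
Hypothesis derD : derivation D.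
Implicit Types (x y : B) (i j n : G) (M : option G).

(** Entries equal to 0 are harmless: they contribute [None]. *)
Definition shift_bound (s : seq B) : option G :=
  \big[@max_bot G/None]_(y <- s) sub_bot (deg (D y)) (deg y).

Lemma shift_boundP s y : y \in s ->
  le_bot (deg (D y)) (add_bot (deg y) (shift_bound s)).
Proof.
rewrite /shift_bound; elim: s => // x s IHs; rewrite inE big_cons.
case/predU1P=> [<-|/IHs le_y].
  case yi: (deg y) => [i|]; last first.
    by move/deg_eq_bot: yi => ->; rewrite derivation0 // deg0.
  by rewrite -le_sub_bot; apply: le_max_botl.
exact: le_bot_trans le_y (le_add_bot2l _ (le_max_botr _ _)).
Qed.

(** This is what makes a bound taken over finitely many elements a greatest shift: the maximum is
    itself a shift, and -oo is the shift of 1. *)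
Lemma shift_bound_attained s : degree_shifts deg D (shift_bound s).
Proof.
have bot : degree_shifts deg D None.
  by exists 1; rewrite ?oner_eq0 // derivation1 // deg0.
elim: s => [|x s IHs]; rewrite /shift_bound ?big_nil // big_cons /max_bot.
case: ifP => // _; have [->|x0] := eqVneq x 0; last by exists x.
by rewrite deg0 /sub_bot /= add_botC.
Qed.

Lemma defined_of_shift_bound s :
  (forall x, le_bot (deg (D x)) (add_bot (deg x) (shift_bound s))) ->
  degree_of_derivation_defined deg D.
Proof.
move=> bound; exists (shift_bound s); split; first exact: shift_bound_attained.
move=> _ [x x0 ->]; have := bound x; case xi: (deg x) => [i|].
  by rewrite le_sub_bot.
by move/deg_eq_bot/eqP: xi; rewrite (negPf x0).
Qed.

(** With [i] only an upper bound for the degree of [x], the condition is stable under sums for fixed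
    [i], even when leading terms cancel, and the indices add up in products. *)
Definition controlled M i x : Prop :=
  le_bot (deg x) (Some i) /\ le_bot (deg (D x)) (add_bot (Some i) M).

Lemma controlled0 M i : controlled M i 0.
Proof. by split; rewrite ?derivation0 // deg0. Qed.

Lemma controlledD M i x y : controlled M i x -> controlled M i y -> controlled M i (x + y).
Proof. by move=> [xi Dx] [yi Dy]; split; rewrite ?derivationD //; apply: deg_leD. Qed.

Lemma controlledN M i x : controlled M i x -> controlled M i (- x).
Proof. by move=> [xi Dx]; split; rewrite ?derivationN // degN. Qed.

Lemma controlledM M i j n x y : i + j = n ->
  controlled M i x -> controlled M j y -> controlled M n (x * y).
Proof.
move=> <- [xi Dx] [yj Dy]; split; first exact: le_degM (erefl _) xi yj.
rewrite derivationM //; apply: deg_leD; rewrite degM.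
  have := le_add_bot Dx yj; rewrite -add_botA [add_bot M _]add_botC add_botA; exact.
by have := le_add_bot xi Dy; rewrite add_botA; exact.
Qed.

Lemma controlled_sum M i (I : Type) (s : seq I) (F : I -> B) :
  (forall l, controlled M i (F l)) -> controlled M i (\sum_(l <- s) F l).
Proof.
move=> ctrl; elim/big_rec: _ => [|l x _]; first exact: controlled0.
exact: controlledD.
Qed.

Lemma controlled_deg M i x : deg x = Some i ->
  controlled M i x <-> le_bot (deg (D x)) (add_bot (deg x) M).
Proof. by move=> xi; rewrite /controlled xi le_bot_refl; split=> [[]|]. Qed.

End ShiftBounds.

(** * Case (b): finitely generated associated graded ring *)

Section FinitelyGeneratedGr.
Variables (k : fieldType) (B : idomainType) (iota : {rmorphism k -> B}).
Variables (G : toagType) (deg : degree_function B G).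
Hypothesis wo : well_ordered_values deg.

Lemma gr_classN i x : le_bot (deg x) (Some i) ->
  gr_class deg i (- x) = - gr_class deg i x.
Proof.
move=> xi; apply: (addrI (gr_class deg i x)).
by rewrite -gr_classD ?degN // !subrr gr_class0.
Qed.

Lemma tame_of_fg_gr : fg_algebra (gr_scalar iota wo) -> tame iota deg.
Proof.
case=> s gen D [derD Diota].
pose reps (f : gr deg) := [seq gr_rep (f i) | i <- gr_supp f & f i != 0].
pose M := shift_bound deg D (flatten [seq reps f | f <- s]).
pose A : {pred gr deg} := fun f => `[< forall i, exists x,
  controlled deg D M i x /\ gr_class deg i x = f i >].
have scalarA c : gr_scalar iota wo c \in A.
  apply/asboolP => i; exists (if i == 0 then iota c else 0); split=> //.
  case: eqP => [->|_]; last exact: controlled0.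
  by split; rewrite ?Diota ?deg0 // well_ordered_scalar_le0.
have AP f : f \in A -> exists F : G -> B,
    forall i, controlled deg D M i (F i) /\ gr_class deg i (F i) = f i.
  by move=> /asboolP fA; have [F FP] := choice fA; exists F.
have subA : subring_closed A.
  split=> [|f g /AP[x xf] /AP[y yg]|f g /AP[x xf] /AP[y yg]].
  - by have := scalarA 1; rewrite rmorph1.
  - apply/asboolP => i; have [[xi xE] [yi yE]] := (xf i, yg i).
    exists (x i - y i); split; first exact/controlledD/controlledN.
    by rewrite gr_classD ?degN ?gr_classN ?xE ?yE //; case: xi yi => ? _ [].
  - apply/asboolP => n; exists (\sum_(i <- gr_supp f) x i * y (n - i)).
    have nE i : i + (n - i) = n by rewrite addrCA subrr addr0.
    have ctrl i : controlled deg D M n (x i * y (n - i)).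
      by apply: (controlledM derD (nE i)); [apply: (xf i).1 | apply: (yg (n - i)).1].
    split; first exact: controlled_sum.
    rewrite gr_class_sum => [|i]; last by case: (ctrl i).
    apply: eq_bigr => i _; rewrite -(xf i).2 -(yg (n - i)).2 (gr_piece_mulE (nE i)) //.
      exact: (xf i).1.1.
    exact: (yg (n - i)).1.1.
have genA : {subset s <= A}.
  move=> f fs; apply/asboolP => i.
  have [fi|fi] := eqVneq (f i) 0.
    by exists 0; rewrite gr_class0 fi; split=> //; apply: controlled0.
  exists (gr_rep (f i)); rewrite gr_repK; split=> //.
  (* A representative of a non-zero class of index [i] has degree exactly [i]; its shift bound is
     therefore control at index [i]. *)
  have degf : deg (gr_rep (f i)) = Some i.
    have := gr_rep_le (f i); case ex: (deg _) => [j|] /= ji; last first.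
      by case/eqP: fi; rewrite -(gr_repK (f i)); move/deg_eq_bot: ex => ->; rewrite gr_class0.
    congr Some; apply/eqP; rewrite eq_le ji /=; apply: contraTT isT => nij.
    case/eqP: fi; rewrite -(gr_repK (f i)) -(gr_class0 deg i).
    by apply/gr_classP; rewrite ?subr0 ?deg0 ?ex.
  apply/controlled_deg => //; apply: shift_boundP => //.
  apply/flattenP; exists (reps f); first exact: map_f.
  apply/mapP; exists i => //; rewrite mem_filter fi.
  by apply: contraNT fi => /gr_suppP->.
have {gen scalarA subA genA} allA f : f \in A by apply: gen.
apply: (defined_of_shift_bound derD (s := flatten [seq reps f | f <- s])).
rewrite -/M => z; apply: contrapT => nz.
(* [S] collects the degrees at which the bound fails. At its minimum [m], some controlled [y] has
   the same class as [x]; then [x - y] has smaller degree, so it obeys the bound, and hence so does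
   [x]. *)
pose S i := exists2 x, deg x = Some i & ~ le_bot (deg (D x)) (add_bot (deg x) M).
have degS x : ~ le_bot (deg (D x)) (add_bot (deg x) M) -> exists i, deg x = Some i.
  case: (deg x) (deg_eq_bot deg x) => [i|[/(_ erefl) -> _]]; first by exists i.
  by rewrite derivation0 // deg0.
case: (wo (S := S)) => [i [x xi _]||m [x xm nx] min].
- by exists x => //; apply/eqP => /(deg_eq_bot deg); rewrite xi.
- by have [i zi] := degS z nz; exists i, z.
have /asboolP/(_ m)[y [[ym Dy]]] := allA (gr_in deg m x).
rewrite /= /gr_in_coef eqxx => yx; apply: nx; rewrite xm.
have /gr_classP : gr_class deg m x = gr_class deg m y by [].
rewrite xm => /(_ (le_bot_refl _) ym) xy.
rewrite -(subrK y x) derivationD //; apply: deg_leD => //.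
apply: (@le_bot_trans _ (add_bot (deg (x - y)) M)); last first.
  exact/le_add_bot2r/lt_botW.
apply: contrapT => nxy; have [i xyi] := degS _ nxy.
by case/negP: xy; rewrite xyi; apply: min; exists (x - y).
Qed.

End FinitelyGeneratedGr.

(** * Graded domains *)

Lemma toag_add_eq (G : toagType) (i i' j j' : G) :
  i <= i' -> j <= j' -> i' + j' = i + j -> i' = i.
Proof.
move=> ii' jj' E; apply/eqP; rewrite eq_le ii' andbT.
have := toag_leD2r i' _ _ jj'; rewrite addrC [j' + i']addrC E => /(toag_leD2r (- j)).
by rewrite !addrK.
Qed.

Lemma seq_extremum (T : eqType) (R : rel T) (s : seq T) : total R -> transitive R ->
  s != [::] -> exists2 i, i \in s & forall j, j \in s -> R i j.
Proof.
move=> Rt Rtr; elim: s => // x s IHs _.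
have Rxx y : R y y by have := Rt y y; rewrite orbb.
have [->|/IHs[i si imin]] := eqVneq s [::].
  by exists x; rewrite ?mem_head // => j; rewrite inE => /eqP->.
have [xi|ix] := orP (Rt x i).
  by exists x; rewrite ?mem_head // => j /predU1P[->//|/imin]; apply: Rtr.
by exists i; [rewrite inE si orbT|move=> j /predU1P[->|/imin]].
Qed.

Section GradedDomains.
Variables (B : idomainType) (G : toagType) (Bi : G -> B -> Prop).
Hypothesis gr : is_grading Bi.
Implicit Types (x y : B) (i j n : G) (l : seq (G * B)).

(** Such a list may repeat a degree, so the product of two decompositions is just the list of all
    pairwise products; [component] regroups it afterwards. *)
Definition homogeneous l : Prop := forall p, p \in l -> Bi p.1 p.2.

Definition component l i : B := \sum_(p <- l | p.1 == i) p.2.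

Lemma grading_add i x y : Bi i x -> Bi i y -> Bi i (x + y).
Proof.
move=> xi yi; rewrite -(opprK y); apply: gradingB => //.
by rewrite -sub0r; apply: gradingB => //; apply: grading0.
Qed.

Lemma component_homog l i : homogeneous l -> Bi i (component l i).
Proof.
move=> hl; rewrite /component big_seq_cond.
elim/big_rec: _ => [|p x /andP[/hl hp /eqP <-]]; first exact: grading0.
exact: grading_add.
Qed.

Lemma sum_component l :
  \sum_(i <- undup [seq p.1 | p <- l]) component l i = \sum_(p <- l) p.2.
Proof.
rewrite /component; under eq_bigr do rewrite big_mkcond.
rewrite exchange_big big_seq [RHS]big_seq; apply: eq_bigr => p pl /=.
rewrite (bigD1_seq p.1) ?undup_uniq ?mem_undup ?map_f //= eqxx big1 ?addr0 // => i.
by rewrite eq_sym => /negPf->.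
Qed.

Lemma component_eq0 l i : homogeneous l -> \sum_(p <- l) p.2 = 0 -> component l i = 0.
Proof.
move=> hl; rewrite -sum_component => l0.
have [li|li] := boolP (i \in undup [seq p.1 | p <- l]).
  by apply: (grading_free gr (undup_uniq _) _ l0) => // j; apply: component_homog.
rewrite /component big_seq_cond big1 // => p /andP[pl /eqP pi].
by case/negP: li; rewrite mem_undup -pi map_f.
Qed.

Definition decomposes (s : seq G) (f : G -> B) x : Prop :=
  [/\ uniq s, forall i, Bi i (f i), forall i, i \in s -> f i != 0 &
      x = \sum_(i <- s) f i].

Lemma exists_decomposition x : exists s f, decomposes s f x.
Proof.
have [s [f [us fB ->]]] := grading_span gr x.
exists [seq i <- s | f i != 0], f; split; rewrite ?filter_uniq //.
  by move=> i; rewrite mem_filter => /andP[].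
by rewrite big_filter [RHS]big_mkcond; apply: eq_bigr => i _; case: eqP.
Qed.

(* Applied with R := <= and with R := >=, to the lowest and highest degrees. *)
Lemma extreme_degreeM (R : rel G) s f x t g y n i0 j0 :
  (forall i i' j j', R i i' -> R j j' -> i' + j' = i + j -> i' = i) ->
  decomposes s f x -> decomposes t g y -> Bi n (x * y) ->
  i0 \in s -> (forall i, i \in s -> R i0 i) ->
  j0 \in t -> (forall j, j \in t -> R j0 j) -> i0 + j0 = n.
Proof.
move=> addR [us fB f0 xE] [ut gB g0 yE] xyn si0 mini0 tj0 minj0.
apply: contrapT => neq.
(* A decomposition of 0. If [i0 + j0] differs from [n], extremality leaves [f i0 * g j0] as the only
   term of degree [i0 + j0], and it is non-zero in a domain. *)
pose l := (n, - (x * y)) :: [seq (i + j, f i * g j) | i <- s, j <- t].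
have hl : homogeneous l.
  move=> p; rewrite inE => /predU1P[->|/allpairsP[[i j] /= [_ _ ->]]] /=.
    by rewrite -sub0r; apply: gradingB => //; apply: grading0.
  exact: gradingM.
have l0 : \sum_(p <- l) p.2 = 0.
  rewrite big_cons /= big_allpairs_dep /= xE yE mulr_suml.
  by rewrite [X in - _ + X](eq_bigr (fun i => f i * \sum_(j <- t) g j)) ?addNr // => i _;
    rewrite mulr_sumr.
have := component_eq0 (i0 + j0) hl l0; rewrite /component big_cons /=.
have /negPf-> : n != i0 + j0 by apply/eqP => /esym.
rewrite big_mkcond big_allpairs_dep /= (bigD1_seq i0) //= (bigD1_seq j0) //= eqxx.
rewrite big_seq_cond big1 => [|j /andP[tj j_j0]]; last first.
  by case: eqP => // /addrI/eqP; rewrite (negPf j_j0).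
rewrite addr0 big_seq_cond big1 => [|i /andP[si i_i0]].
  by rewrite addr0 => /eqP; rewrite mulf_eq0 (negPf (f0 _ si0)) (negPf (g0 _ tj0)).
rewrite big_seq big1 // => j tj; case: eqP => // /(addR _ _ _ _ (mini0 _ si) (minj0 _ tj)) E.
by rewrite E eqxx in i_i0.
Qed.

(** The lowest degrees of [x] and [y] add up to [n], and so do the highest ones; hence [x] has a
    single degree. *)
Lemma homogeneous_factor n x y : x * y != 0 -> Bi n (x * y) -> exists i, Bi i x.
Proof.
rewrite mulf_eq0 negb_or => /andP[x0 y0] xyn.
have [s [f dx]] := exists_decomposition x; have [t [g dy]] := exists_decomposition y.
have [us fB _ xE] := dx; have [_ _ _ yE] := dy.
have s0 : s != [::] by apply: contra_neq x0 => s0; rewrite xE s0 big_nil.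
have t0 : t != [::] by apply: contra_neq y0 => t0; rewrite yE t0 big_nil.
have le_tr : transitive (<=%R : rel G) by move=> ? ? ?; apply: le_trans.
have ge_total : total (>=%R : rel G) by move=> i j; apply: toag_le_total.
have ge_tr : transitive (>=%R : rel G) by move=> j i l /= ji lj; apply: le_trans lj ji.
have [i si mini] := seq_extremum (@toag_le_total G) le_tr s0.
have [j tj minj] := seq_extremum (@toag_le_total G) le_tr t0.
have [i' si' maxi] := seq_extremum ge_total ge_tr s0.
have [j' tj' maxj] := seq_extremum ge_total ge_tr t0.
have minE := extreme_degreeM (@toag_add_eq G) dx dy xyn si mini tj minj.
have maxE : i' + j' = n.
  apply: (extreme_degreeM _ dx dy xyn si' maxi tj' maxj) => a a' b b' /= aa' bb' E.
  by apply/esym/(toag_add_eq aa' bb').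
have ii' : i' = i by apply: toag_add_eq (mini _ si') (minj _ tj') _; rewrite minE.
exists i; rewrite xE (bigD1_seq i) //= big_seq_cond big1 ?addr0 // => m /andP[sm].
by case/eqP; apply/eqP; rewrite eq_le mini // andbT; have := maxi _ sm; rewrite /= ii'.
Qed.

(** The element 1 divides each of its own components, so it is homogeneous, and a unit divides 1.
    This makes the scalars homogeneous. *)
Lemma homogeneous_unit x y : x * y = 1 -> exists i, Bi i x.
Proof.
move=> xy; have [s [f [us fB f0 E1]]] := exists_decomposition 1.
have [n n1] : exists n, Bi n 1.
  case: s us f0 E1 => [|i s] us f0 E1; first by move/eqP: E1; rewrite big_nil oner_eq0.
  by apply: (@homogeneous_factor i _ (f i)); rewrite mul1r // f0 ?mem_head.
by apply: (@homogeneous_factor n _ y); rewrite xy // oner_eq0.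
Qed.

(** * Case (a): finitely generated graded domains *)

Section FinitelyGenerated.
Variables (k : fieldType) (iota : {rmorphism k -> B}) (deg : degree_function B G).
Hypothesis degE : determined_by Bi deg.

Lemma deg_ge_component s f i : uniq s -> (forall i, Bi i (f i)) -> i \in s -> f i != 0 ->
  le_bot (Some i) (deg (\sum_(i <- s) f i)).
Proof. by move=> us fB si fi0; case: (degE us fB) => _; apply; right; exists i. Qed.

Lemma deg_homogeneous i x : Bi i x -> x != 0 -> deg x = Some i.
Proof.
move=> xi x0; pose f j := if j == i then x else 0.
have fB j : Bi j (f j) by rewrite /f; case: eqP => [->|_] //; apply: grading0.
case: (degE (erefl : uniq [:: i]) fB); rewrite big_seq1 /f eqxx => -[|[j]] + _.
  by move/deg_eq_bot/eqP; rewrite (negPf x0).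
by rewrite inE => -[/eqP-> _].
Qed.

Lemma tame_of_fg_graded : fg_algebra iota -> tame iota deg.
Proof.
case=> gens gen D [derD Diota].
have /choice[dec decP] x : exists p : seq G * (G -> B), decomposes p.1 p.2 x.
  by have [s [f dx]] := exists_decomposition x; exists (s, f).
pose parts x := [seq (dec x).2 i | i <- (dec x).1].
pose M := shift_bound deg D (flatten [seq parts x | x <- gens]).
pose ok l := forall p, p \in l -> Bi p.1 p.2 /\ controlled deg D M p.1 p.2.
pose A : {pred B} := fun x => `[< exists2 l, ok l & x = \sum_(p <- l) p.2 >].
have iotaA c : iota c \in A.
  apply/asboolP; have [->|c0] := eqVneq c 0; first by exists [::]; rewrite ?big_nil ?rmorph0.
  have [i ci] : exists i, Bi i (iota c).
    by apply: (@homogeneous_unit _ (iota c^-1)); rewrite -rmorphM mulfV // rmorph1.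
  exists [:: (i, iota c)]; rewrite ?big_seq1 // => _ /[!inE]/eqP-> /=; split=> //.
  split; last by rewrite Diota deg0.
  by rewrite (deg_homogeneous ci) ?le_bot_refl // fmorph_eq0.
have subA : subring_closed A.
  split=> [|_ _ /asboolP[l okl ->] /asboolP[m okm ->]
           |_ _ /asboolP[l okl ->] /asboolP[m okm ->]].
  - by have := iotaA 1; rewrite rmorph1.
  - apply/asboolP; exists (l ++ [seq (p.1, - p.2) | p <- m]); last first.
      by rewrite big_cat big_map /= sumrN.
    move=> p; rewrite mem_cat => /orP[/okl//|/mapP[q /okm[qB qM] ->]] /=.
    split; last exact: controlledN.
    by rewrite -sub0r; apply: gradingB => //; apply: grading0.
  - apply/asboolP; exists [seq (p.1 + q.1, p.2 * q.2) | p <- l, q <- m]; last first.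
      by rewrite big_allpairs_dep mulr_suml; apply: eq_bigr => p _; rewrite mulr_sumr.
    move=> _ /allpairsP[[p q] /= [/okl[pB pM] /okm[qB qM] ->]] /=.
    by split; [apply: gradingM | apply: controlledM pM qM].
have genA : {subset gens <= A}.
  move=> x xg; apply/asboolP; have [us fB f0 xE] := decP x.
  exists [seq (i, (dec x).2 i) | i <- (dec x).1]; last by rewrite big_map.
  move=> _ /mapP[i si ->] /=; split=> //.
  apply/controlled_deg; first by rewrite (deg_homogeneous (fB i)) // f0.
  apply: shift_boundP => //; apply/flattenP; exists (parts x); exact: map_f.
have {gen iotaA subA genA} allA x : x \in A by apply: gen.
apply: (defined_of_shift_bound derD (s := flatten [seq parts x | x <- gens])).
rewrite -/M => x; have /asboolP[l okl ->] := allA x.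
have hl : homogeneous l by move=> p /okl[].
(* Terms of equal degree are regrouped first: a non-zero component of degree [i] then forces the sum
   to have degree at least [i], which a single entry of [l] need not do. *)
rewrite -[in D _]sum_component derivation_sum //; apply: deg_le_sum => i li.
have [->|ci0] := eqVneq (component l i) 0; first by rewrite derivation0 // deg0.
apply: (@le_bot_trans _ (add_bot (Some i) M)); last first.
  apply: le_add_bot2r; rewrite -sum_component; apply: deg_ge_component => //.
    exact: undup_uniq.
  by move=> j; apply: component_homog.
suff [] : controlled deg D M i (component l i) by [].
rewrite /component big_seq_cond.
elim/big_rec: _ => [|p y /andP[/okl[_ pM] /eqP <-]]; first exact: controlled0.
exact: controlledD.
Qed.

End FinitelyGenerated.

End GradedDomains.

(** * Degree functions with values in the natural numbers *)

Section NatDegree.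
Variables (k : fieldType) (B : idomainType) (iota : {rmorphism k -> B}).
Hypothesis char0 : [pchar k] =i pred0.
Variable deg : degree_function B int.
Hypothesis deg_nat : values_in_nat deg.
Implicit Types (a x y z u w : B) (M d e : int).

Lemma natr_neq0 n : (n.+1)%:R != 0 :> B.
Proof. by rewrite -(rmorph_nat iota) fmorph_eq0 ((pcharf0P k).1 char0). Qed.

(** The degrees of a non-zero scalar and of its inverse are natural numbers with sum 0. *)
Lemma deg_scalar c : iota c \in filt_le deg 0.
Proof.
rewrite unfold_in; have [->|c0] := eqVneq c 0; first by rewrite rmorph0 deg0.
have [m cm] : exists m : nat, deg (iota c) = Some m%:Z by apply: deg_nat; rewrite fmorph_eq0.
have [n cn] : exists n : nat, deg (iota c^-1) = Some n%:Z.
  by apply: deg_nat; rewrite fmorph_eq0 invr_eq0.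
have := degM deg (iota c) (iota c^-1).
by rewrite -rmorphM divff // rmorph1 deg1 cm cn /= => -[]; lia.
Qed.

Lemma deg_filt0 a : a \in filt_le deg 0 -> a != 0 -> deg a = Some 0.
Proof.
rewrite unfold_in => a0 /deg_nat[n an]; move: a0; rewrite an /= => n0; congr Some; lia.
Qed.

Lemma filt0_closed : subring_closed (filt_le deg 0).
Proof.
split; first by rewrite unfold_in deg1 le_bot_refl.
  by move=> x y; rewrite !unfold_in => x0 y0; apply: deg_leB.
by move=> x y; rewrite !unfold_in => x0 y0; apply: le_degM x0 y0.
Qed.

Lemma le_degX a n : le_bot (deg a) (Some 0) -> le_bot (deg (a ^+ n)) (Some 0).
Proof.
move=> a0; elim: n => [|n IHn]; first by rewrite deg1 le_bot_refl.
by rewrite exprS; apply: le_degM a0 IHn.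
Qed.

Section Derivation.
Variable D : B -> B.
Hypothesis derD : derivation D.

Lemma derivation_horner (p : {poly B}) a :
  D p.[a] = (map_poly D p).[a] + p^`().[a] * D a.
Proof.
elim/poly_ind: p => [|p c IHp].
  by rewrite deriv0 map_poly0 !horner0 derivation0 // mul0r addr0.
have -> : map_poly D (p * 'X + c%:P) = map_poly D p * 'X + (D c)%:P.
  apply/polyP=> i; rewrite coef_map_id0 ?derivation0 // !coefD !coefMX !coefC.
  rewrite derivationD // coef_map_id0 ?derivation0 //.
  by case: i => [|i] /=; rewrite (derivation0 derD).
rewrite derivD derivM derivX derivC mulr1 addr0 !hornerE derivationD //.
rewrite derivationM // IHp mulrDl mulrDl; ring.
Qed.

Lemma controlled_le M d e x : d <= e -> controlled deg D (Some M) d x ->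
  controlled deg D (Some M) e x.
Proof.
move=> de [xd Dx]; split; first by apply: le_bot_trans xd _.
by apply: le_bot_trans Dx _; rewrite /= lerD2r.
Qed.

(** A non-empty set of integers bounded above has a greatest element, found here as the least gap
    [n] below [M]. If no shift is an integer, the greatest one is -oo, the shift of 1. *)
Lemma bounded_shifts_defined M :
  (forall x, le_bot (deg (D x)) (add_bot (deg x) (Some M))) ->
  degree_of_derivation_defined deg D.
Proof.
move=> bound; pose P n := `[< degree_shifts deg D (Some (M - n%:Z)) >].
have leU v : degree_shifts deg D (Some v) -> exists n : nat, v = M - n%:Z.
  case=> x x0; have [m xm] := deg_nat x0; have := bound x; rewrite xm.
  case: (deg (D x)) => //= j jm [->]; exists (absz (M - (j - m%:Z))%R); lia.
have [exP|nP] := pselect (exists n, P n); last first.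
  exists None; split.
    by have := shift_bound_attained deg derD [::]; rewrite /shift_bound big_nil.
  move=> [v|//] /[dup]/leU[n ->] Un; case: nP; exists n; exact/asboolP.
case: (ex_minnP exP) => n /asboolP Un minn; exists (Some (M - n%:Z)); split=> //.
move=> [v|//] /[dup]/leU[m ->] Um; have : (n <= m)%N by apply/minn/asboolP.
rewrite /=; lia.
Qed.

Definition controlled0_pred M : {pred B} := fun a => `[< controlled deg D (Some M) 0 a >].

Lemma controlled0_predP M a :
  reflect (controlled deg D (Some M) 0 a) (a \in controlled0_pred M).
Proof. exact: asboolP. Qed.

Lemma controlled0_closed M : subring_closed (controlled0_pred M).
Proof.
split=> [|x y /controlled0_predP xM /controlled0_predP yM
         |x y /controlled0_predP xM /controlled0_predP yM]; apply/controlled0_predP.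
- by split; rewrite ?derivation1 // ?deg1 ?deg0.
- exact/controlledD/controlledN.
- exact: (controlledM derD (addr0 0) xM yM).
Qed.

(* For a minimal annihilating polynomial p of a, the element p'(a) has degree 0
   and p'(a) D(a) = - p^D(a). *)
Lemma controlled0_algebraic M a (p : {poly B}) : a \in filt_le deg 0 -> p != 0 ->
  (forall i, p`_i \in controlled0_pred M) -> p.[a] = 0 -> a \in controlled0_pred M.
Proof.
move=> a0; have [n] := ubnP (size p); elim: n p => // n IHn p /ltnSE sp p0 pM pa.
have [_ subB subM] := controlled0_closed M.
have M0 : 0 \in controlled0_pred M by apply/controlled0_predP/controlled0.
have sp1 : (1 < size p)%N.
  rewrite ltnNge; apply: contra_neqN p0 => /size1_polyC pE.
  by move: pa; rewrite pE hornerC => ->.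
(* In characteristic zero the leading coefficient of [p] survives differentiation, up to the
   non-zero factor [(size p).-1]. *)
have dp0 : p^`() != 0.
  apply: contra_neq p0 => /(congr1 (fun q : {poly B} => q`_(size p).-2)).
  rewrite coef_deriv coef0 prednK -?subn1 ?subn_gt0 // subn1 -mulr_natr => /eqP.
  rewrite mulf_eq0 -[X in (X)%:R](prednK (_ : 0 < (size p).-1)%N); last by lia.
  by rewrite (negPf (natr_neq0 _)) orbF lead_coef_eq0 => /eqP.
have dpM i : p^`()`_i \in controlled0_pred M.
  rewrite coef_deriv; move: (pM i.+1); move: (p`_i.+1) => c cM.
  elim: i.+1 => [|m IHm]; first by rewrite mulr0n.
  by rewrite mulrS -[_ *+ m]opprK; apply/subB => //; rewrite -sub0r; apply/subB.
(* If the derivative also kills [a], it replaces [p]; this descent stands for the choice of a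
   minimal polynomial. *)
have [/IHn dpa|dpa0] := eqVneq p^`().[a] 0.
  by apply: dpa dp0 dpM; apply: leq_trans sp; apply: lt_size_deriv.
have horner_le (q : {poly B}) d : (forall i, le_bot (deg q`_i) (Some d)) ->
    le_bot (deg q.[a]) (Some d).
  move=> qd; rewrite horner_coef; apply: deg_le_sum => i _.
  by apply: (le_degM (addr0 d)) => //; apply: le_degX.
apply/controlled0_predP; split=> //; have := derivation_horner p a.
rewrite pa derivation0 // => /esym/eqP; rewrite addrC addr_eq0 => /eqP Da.
have <- : deg (p^`().[a] * D a) = deg (D a).
  rewrite degM deg_filt0 //=; first by case: (deg (D a)) => //= m; rewrite add0r.
  by apply: horner_le => i; have /controlled0_predP[] := dpM i.
rewrite Da degN /= add0r; apply: horner_le => i; rewrite coef_map_id0 ?derivation0 //.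
by have /controlled0_predP[_] := pM i; rewrite /= add0r.
Qed.

End Derivation.
End NatDegree.

(** * A uniform bound on the elements of degree at most 0 *)

Section BoundOnDegreeZero.
Variables (k : fieldType) (B : idomainType) (iota : {rmorphism k -> B}).
Hypothesis char0 : [pchar k] =i pred0.
Variable deg : degree_function B int.
Hypothesis deg_nat : values_in_nat deg.
Variable D : B -> B.
Hypotheses (derD : derivation D) (Diota : forall c, D (iota c) = 0).
Local Notation L := {fraction B}.

Definition tofrac_image (R : {pred B}) : {pred L} :=
  fun z => `[< exists2 a, a \in R & z = tofrac a >].

Lemma tofrac_imageP (R : {pred B}) z :
  reflect (exists2 a, a \in R & z = tofrac a) (z \in tofrac_image R).
Proof. exact: asboolP. Qed.

Lemma tofrac_image_closed (R : {pred B}) : subring_closed R -> subring_closed (tofrac_image R).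
Proof.
case=> R1 RB RM; split=> [|_ _ /tofrac_imageP[a Ra ->] /tofrac_imageP[b Rb ->]
                          |_ _ /tofrac_imageP[a Ra ->] /tofrac_imageP[b Rb ->]];
  apply/tofrac_imageP.
- by exists 1; rewrite ?rmorph1.
- by exists (a - b); rewrite ?RB // rmorphB.
- by exists (a * b); rewrite ?RM // rmorphM.
Qed.

Lemma tofrac_poly (R : {pred B}) (p : {poly L}) :
  0 \in R -> (forall i, p`_i \in tofrac_image R) ->
  exists2 q : {poly B}, forall i, q`_i \in R & p = map_poly (@tofrac B) q.
Proof.
move=> R0 pR; have /choice[f fP] i : exists a, a \in R /\ p`_i = tofrac a.
  by have /tofrac_imageP[a] := pR i; exists a.
exists (\poly_(i < size p) f i) => [i|].
  by rewrite coef_poly; case: ifP => // _; case: (fP i).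
apply/polyP=> i; rewrite coef_map coef_poly /=.
by case: ltnP => ip; [case: (fP i) | rewrite nth_default // rmorph0].
Qed.

Lemma algebraic_over_tofrac (R : {pred B}) (a : B) : subring_closed R ->
  algebraic_over (fun z => z \in frac_pred (tofrac_image R)) (tofrac a) ->
  exists p : {poly B}, [/\ p != 0, forall i, p`_i \in R & p.[a] = 0].
Proof.
move=> Rr /(algebraic_over_frac_pred (tofrac_image_closed Rr))[p [p0 pR pa]].
have R0 := subring_closed0 Rr.
have [q qR pE] := tofrac_poly R0 pR; exists q; split=> //.
  by apply: contra_neq p0; rewrite pE => ->; rewrite rmorph0.
by apply/eqP; rewrite -(tofrac_eq0 q.[a]) -horner_map -pE.
Qed.

(** Without a bound, [n + 1] independent elements could be found. Given [t], choose [M] controlling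
    its entries and [a] not controlled by [M]: were [a] algebraic over $k(t)$, it would be so over
    the subring controlled by [M], hence lie in it. *)
Lemma controlled_on_filt0 : finite_trdeg_domain iota ->
  exists M : int, forall a, a \in filt_le deg 0 -> controlled deg D (Some M) 0 a.
Proof.
case=> n [x [_ alg_x]]; apply: contrapT => unbounded.
pose kL (z : L) := exists c, z = tofrac (iota c).
pose S (z : L) := False.
have xP y : alg_closure kL (adds S (codom x)) y.
  by apply: alg_closure_mono (alg_x y) => z [i ->]; left; apply: codom_f.
suff [t tS size_t] : exists2 t, independent_chain kL S t & size t = n.+1.
  by have := independent_chain_size xP tS; rewrite size_t size_codom card_ord ltnn.
have [t [tS <- _]] : exists t, [/\ independent_chain kL S t, size t = n.+1 &
    forall z, z \in t -> exists2 a, a \in filt_le deg 0 & z = tofrac a].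
  elim: n.+1 => [|m [t [tS tm tA]]]; first by exists [::].
  have [M tM] : exists M : int, forall z, z \in t ->
      z \in tofrac_image (controlled0_pred deg D M).
    elim: t tA {tS tm} => [_|z t IHt tA]; first by exists 0.
    have [|M tM] := IHt; first by move=> w wt; apply: tA; rewrite inE wt orbT.
    have [a a0 zE] := tA z (mem_head _ _).
    have [N aN] : exists N : int, controlled deg D (Some N) 0 a.
      case Da: (deg (D a)) => [N|]; last by exists 0; split; rewrite ?Da.
      by exists N; split=> //; rewrite Da /= add0r.
    exists (Num.max M N) => w; rewrite inE => /predU1P[->|/tM/tofrac_imageP[b]].
      apply/tofrac_imageP; exists a => //; apply/controlled0_predP.
      case: aN => _ aN; split=> //; apply: (le_bot_trans aN).
      by rewrite /= lerD2l le_max lexx orbT.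
    move=> /controlled0_predP[b0 bM] ->; apply/tofrac_imageP; exists b => //.
    apply/controlled0_predP; split=> //; apply: (le_bot_trans bM).
    by rewrite /= lerD2l le_max lexx.
  have [a a0 naM] : exists2 a, a \in filt_le deg 0 & ~ controlled deg D (Some M) 0 a.
    apply: contrapT => naM; apply: unbounded; exists M => a a0.
    by apply: contrapT => aM; apply: naM; exists a.
  exists (rcons t (tofrac a)); rewrite size_rcons tm; split=> //; last first.
    by move=> z; rewrite mem_rcons inE => /predU1P[->|/tA//]; exists a.
  apply: independent_chain_rcons => // clo.
  have Rr := controlled0_closed deg derD M.
  have [p [p0 pM pa]] : exists p : {poly B},
      [/\ p != 0, forall i, p`_i \in controlled0_pred deg D M & p.[a] = 0].
    apply: (algebraic_over_tofrac Rr); apply: algebraic_over_sub clo => z; apply.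
    - exact/frac_pred_closed/tofrac_image_closed.
    - move=> _ [c ->]; apply/(sub_frac_pred (tofrac_image_closed Rr))/tofrac_imageP.
      exists (iota c) => //; apply/controlled0_predP; split; last by rewrite Diota deg0.
      exact: (deg_scalar iota deg_nat).
    - by move=> w [/tM ?|[]]; apply/(sub_frac_pred (tofrac_image_closed Rr)).
  apply/naM/controlled0_predP.
  exact: (controlled0_algebraic iota char0 deg_nat derD a0 p0 pM pa).
by exists t.
Qed.

End BoundOnDegreeZero.

(** * From degree 0 to all degrees *)

Section GenerationUpToDegree.
Variables (B : idomainType) (deg : degree_function B int).
Hypothesis deg_nat : values_in_nat deg.
Variable D : B -> B.
Hypothesis derD : derivation D.
Variable M : int.
Hypothesis filt0M : forall a, a \in filt_le deg 0 -> controlled deg D (Some M) 0 a.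

Lemma controlled_by_generation (x : B) (e : int) :
  0 < e -> controlled deg D (Some M) e x -> deg x = Some e ->
  (forall z d, deg z = Some d -> exists a u w,
    [/\ a \in filt_le deg 0, a != 0, controlled deg D (Some M) d u &
        lt_bot (deg (a * z - u - x * w)) (Some d)]) ->
  forall z, le_bot (deg (D z)) (add_bot (deg z) (Some M)).
Proof.
move=> e0 xM xe gen z.
have [->|z0] := eqVneq z 0; first by rewrite derivation0 // deg0.
have [n zn] := deg_nat z0.
elim/ltn_ind: n z z0 zn => n IHn z z0 zn.
(* Used with [j] equal to [e] for the cofactor [w], of degree at most [n - e], and with [j] equal to
   0 for the remainder, of degree less than [n]. *)
have IH y (i j : int) : le_bot (deg y) (Some i) -> i + j <= n%:Z ->
    (0 < j \/ i < n%:Z /\ j = 0) ->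
    controlled deg D (Some M) i y.
  have [->|y0] := eqVneq y 0; first by move=> *; apply: controlled0.
  have [m ym] := deg_nat y0; rewrite ym /= => mi ij j0.
  apply: (controlled_le mi); apply/controlled_deg => //; apply: (IHn m) => //; lia.
have [a [u [w [a0 an0 [un Du] ltd]]]] := gen z _ zn.
have az : controlled deg D (Some M) n (a * z).
  have -> : a * z = (a * z - u - x * w) + u + x * w by ring.
  have xw : le_bot (deg (x * w)) (Some n%:Z).
    have -> : x * w = a * z - u - (a * z - u - x * w) by ring.
    apply: deg_leB; last exact: lt_botW.
    by apply: deg_leB => //; apply: (le_degM (add0r _) a0); rewrite zn le_bot_refl.
  apply: controlledD => //; first apply: controlledD => //.
    move: ltd; case ry: (deg _) => [i|] ltd.
      apply: (@controlled_le _ _ _ _ i); first exact: lt_botW ltd.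
      by apply: (IH _ i 0); rewrite ?ry ?le_bot_refl //; move: ltd; rewrite /lt_bot /=; lia.
    by move/deg_eq_bot: ry => ->; apply: controlled0.
  have wM : controlled deg D (Some M) (n%:Z - e) w.
    apply: (IH _ _ e); [|lia|by left].
    move: xw; rewrite degM xe; case: (deg w) => //= i; lia.
  by apply: (controlledM derD _ xM wM); lia.
(* Since [a] has degree 0, the bound on [D (a * z)] passes to [D z] through $a D(z) = D(az) - D(a)
   z$. *)
have -> : deg (D z) = deg (a * D z).
  by rewrite degM (deg_filt0 deg_nat a0 an0); case: (deg (D z)) => //= i; rewrite add0r.
have -> : a * D z = D (a * z) - D a * z by rewrite (derivationM derD); ring.
rewrite zn; apply: deg_leB; first by case: az.
have [_ aM] := filt0M a0.
rewrite degM zn; have := le_add_bot2r (Some n%:Z) aM.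
by rewrite /= add0r addrC.
Qed.

End GenerationUpToDegree.

Section NatDegreeBounds.
Variables (B : idomainType) (deg : degree_function B int).
Variable D : B -> B.
Hypothesis derD : derivation D.

Lemma controlled_common_bound (s : seq B) (P : B -> Prop) (M0 : int) :
  (forall a, P a -> controlled deg D (Some M0) 0 a) ->
  exists M : int, (forall a, P a -> controlled deg D (Some M) 0 a) /\
    forall y d, y \in s -> deg y = Some d -> controlled deg D (Some M) d y.
Proof.
(* The shift bound of [s] may be -oo, whereas [M] has to be an integer; [M0] is then a harmless
   substitute. *)
move=> PM; pose N := if shift_bound deg D s is Some N then N else M0.
exists (Num.max M0 N); split=> [a /PM[a0 Da]|y d ys yd].
  by split=> //; apply: le_bot_trans Da _; rewrite /= lerD2l le_max lexx.
apply/controlled_deg => //; apply: le_bot_trans (shift_boundP deg derD ys) _.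
apply: le_add_bot2l; rewrite /N; case: (shift_bound _ _ _) => //= m.
by rewrite le_max lexx orbT.
Qed.

End NatDegreeBounds.

(** * Locally nilpotent derivations *)

Section LocallyNilpotent.
Variables (B : idomainType) (deg : degree_function B int) (Delta : B -> B).
Hypotheses (derDelta : derivation Delta) (degE : is_deg_of_lnd Delta deg).

Lemma lnd_values_in_nat : values_in_nat deg.
Proof. by move=> x /(degE.2 x)[n [_ _ xn]]; exists n. Qed.

Lemma iter_derivation0 n : iter n Delta 0 = 0.
Proof. by elim: n => //= n ->; rewrite derivation0. Qed.

Lemma lnd_degP x n : deg x = Some n%:Z -> iter n Delta x != 0 /\ iter n.+1 Delta x = 0.
Proof.
move=> xn; have x0 : x != 0 by apply/eqP => /(deg_eq_bot deg); rewrite xn.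
have [m [xm maxm]] := degE.2 x x0; rewrite xn => -[nm].
rewrite nm; split=> //; apply: contrapT => /eqP/maxm; lia.
Qed.

Lemma lnd_deg_lt x n : iter n Delta x = 0 -> lt_bot (deg x) (Some n%:Z).
Proof.
move=> xn; have [->|x0] := eqVneq x 0; first by rewrite deg0.
have [m [xm _ ->]] := degE.2 x x0; rewrite /lt_bot /= -ltNge ltz_nat ltnNge.
by apply: contra xm => nm; rewrite -(subnK nm) iterD xn iter_derivation0.
Qed.

Lemma lnd_kernel a : deg a = Some 0 -> Delta a = 0.
Proof. by case/(@lnd_degP _ 0). Qed.

Lemma iter_kernelM n a x : Delta a = 0 -> iter n Delta (a * x) = a * iter n Delta x.
Proof.
by move=> a0; elim: n => //= n ->; rewrite derivationM // a0 mul0r add0r.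
Qed.

(** The last non-zero iterate lies in the kernel, so it has degree 0: it can serve as a coefficient
    that commutes with [Delta]. *)
Lemma lnd_iter_kernel x n : deg x = Some n%:Z ->
  iter n Delta x != 0 /\ deg (iter n Delta x) = Some 0.
Proof.
move=> /lnd_degP[xn0 xn]; split=> //.
have := lnd_deg_lt (xn : iter 1 Delta (iter n Delta x) = 0).
by have [m ->] := lnd_values_in_nat xn0; rewrite /lt_bot /= => m1; congr Some; lia.
Qed.

Lemma local_slice x n : deg x = Some n.+1%:Z -> deg (iter n Delta x) = Some 1.
Proof.
move=> /lnd_degP[xn0 xn].
have t0 : iter n Delta x != 0.
  by apply: contra_neq xn0 => xn0; rewrite iterS xn0 derivation0.
have [m [tm maxm tE]] := degE.2 _ t0; rewrite tE.
have : (1 <= m)%N by apply: maxm.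
have := lnd_deg_lt (xn : iter 2 Delta (iter n Delta x) = 0).
by rewrite tE /lt_bot /= => ? ?; congr Some; lia.
Qed.

Lemma deg_exp x n d : deg x = Some d -> deg (x ^+ n) = Some (d *+ n).
Proof. by move=> xd; elim: n => [|n IHn]; rewrite ?deg1 // exprS degM xd IHn mulrS. Qed.

Lemma tame_of_lnd (k : fieldType) (iota : {rmorphism k -> B}) :
  [pchar k] =i pred0 -> finite_trdeg_domain iota -> tame iota deg.
Proof.
move=> char0 ftr D [derD Diota]; have deg_nat := lnd_values_in_nat.
have [M0 M0P] := controlled_on_filt0 char0 deg_nat derD Diota ftr.
(* If no element has positive degree, [M0] already bounds [D] on all of [B]. *)
have [[x [n xn]]|triv] := pselect (exists x n, deg x = Some n.+1%:Z); last first.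
  apply: (bounded_shifts_defined deg_nat derD (M := M0)) => z.
  have [->|z0] := eqVneq z 0; first by rewrite derivation0 // deg0.
  have [[|m] zm] := deg_nat z z0; last by case: triv; exists z, m.
  by have [] : controlled deg D (Some M0) 0 z; [apply: M0P; rewrite unfold_in zm | rewrite zm].
set t := iter n Delta x; have t1 : deg t = Some 1 := local_slice xn.
have [M [MP Mt]] := controlled_common_bound derD [:: t] M0P.
apply: (bounded_shifts_defined deg_nat derD (M := M)).
apply: (controlled_by_generation deg_nat derD MP (ltr01 : 0 < 1) _ t1).
  by apply: Mt; rewrite ?mem_head.
move=> z d zd; have z0 : z != 0 by apply/eqP => /(deg_eq_bot deg); rewrite zd.
have [m] := deg_nat z z0; rewrite zd => -[dm]; rewrite {d}dm in zd *.
case: m zd => [|m] zd.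
  exists 1, z, 0; split; rewrite ?oner_eq0 //.
  - by rewrite unfold_in deg1.
  - by apply: MP; rewrite unfold_in zd.
  - by rewrite mul1r mulr0 subrr subr0 deg0.
have tm : deg (t ^+ m.+1) = Some m.+1%:Z by rewrite (deg_exp _ t1) natz.
(* With $a = \Delta^{m+1}(t^{m+1})$ and $c = \Delta^{m+1}(z)$, both in the kernel, $\Delta^{m+1}$
   kills $az - ct^{m+1}$, which thus has degree at most [m]. *)
have [a0 adeg] := lnd_iter_kernel tm; have [_ cdeg] := lnd_iter_kernel zd.
set a := iter _ _ (t ^+ _) in a0 adeg; set c := iter _ _ z in cdeg.
exists a, 0, (c * t ^+ m); split=> //; first by rewrite unfold_in adeg.
  exact: controlled0.
apply: lnd_deg_lt.
have -> : a * z - 0 - t * (c * t ^+ m) = a * z - c * t ^+ m.+1 by rewrite exprS; ring.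
have iterB l u v : iter l Delta (u - v) = iter l Delta u - iter l Delta v.
  by elim: l => //= l ->; rewrite derivationB.
by rewrite iterB !iter_kernelM ?lnd_kernel // -/a -/c mulrC subrr.
Qed.

End LocallyNilpotent.

(** * Function fields of one variable *)

Section OneDimensional.
Variables (B : idomainType) (deg : degree_function B int).
Hypothesis deg_nat : values_in_nat deg.
Local Notation A := (filt_le deg 0).
Local Notation L := {fraction B}.
Variables (x : B) (e : int).
Hypotheses (e0 : 0 < e) (xe : deg x = Some e).

(* The classes of the y_i in B / xB form an A-independent family on which the
   quotient of the filtration is the maximum of the degrees. *)
Definition orthogonal_mod (y : seq B) : Prop :=
  (forall j, (j < size y)%N -> y`_j != 0) /\
  forall (c : nat -> B) (w : B) (j : nat), (forall i, c i \in A) ->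
    (j < size y)%N -> c j != 0 ->
    le_bot (deg y`_j) (deg (\sum_(i < size y) c i * y`_i + x * w)).

Lemma x_neq0 : x != 0.
Proof. by apply/eqP => /(deg_eq_bot deg); rewrite xe. Qed.

(** Modulo [x] only the constant terms of the [p i] remain, and orthogonality kills them; dividing
    by [x] lowers the sizes. *)
Lemma orthogonal_independent y (p : nat -> {poly B}) : orthogonal_mod y ->
  (forall i j, (p i)`_j \in A) -> \sum_(i < size y) (p i).[x] * y`_i = 0 ->
  forall i, (i < size y)%N -> p i = 0.
Proof.
case=> y0 orth; have [n] : exists n, forall i, (i < size y)%N -> (size (p i) <= n)%N.
  exists (\max_(i < size y) size (p i))%N => i iy.
  exact: (leq_bigmax (Ordinal iy)).
elim: n p => [|n IHn] p sp pA p0 i iy.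
  by apply/eqP; rewrite -size_poly_eq0 -leqn0 sp.
pose q i := drop_poly 1 (p i).
have pE m : p m = ((p m)`_0)%:P + q m * 'X.
  apply/polyP=> l; rewrite coefD coefC coefMX coef_drop_poly.
  by case: l => [|l]; rewrite ?addr0 ?add0r ?addn1.
have sum_pE : \sum_(i < size y) (p i).[x] * y`_i =
    \sum_(i < size y) (p i)`_0 * y`_i + x * \sum_(i < size y) (q i).[x] * y`_i.
  rewrite mulr_sumr -big_split; apply: eq_bigr => m _ /=.
  by rewrite [in LHS](pE m) hornerD hornerC hornerM hornerX; ring.
have c0 m : (m < size y)%N -> (p m)`_0 = 0.
  move=> my; apply: contrapT => /eqP pm0.
  have := orth (fun i => (p i)`_0) _ m (fun i => pA i 0%N) my pm0.
  move/(_ (\sum_(i < size y) (q i).[x] * y`_i)); rewrite -sum_pE p0 deg0.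
  case ym: (deg y`_m) => [d|] //= _; move/deg_eq_bot: ym => ym.
  by have := y0 m my; rewrite ym eqxx.
have q0 : q i = 0.
  apply: (IHn q) iy => [m my|m j|].
  - by rewrite size_drop_poly leq_subLR add1n sp.
  - by rewrite coef_drop_poly.
  apply: (mulfI x_neq0); rewrite mulr0 -[RHS]p0 sum_pE.
  by rewrite [X in _ = X + _]big1 ?add0r // => m _; rewrite c0 // mul0r.
by rewrite pE c0 // q0 mul0r addr0.
Qed.

(** Every non-zero element has degree at least 0, so it suffices that $c + xw$ not vanish: [c] has
    degree 0, while a non-zero $xw$ has degree at least [e]. *)
Lemma orthogonal1 : orthogonal_mod [:: 1].
Proof.
split=> [[|//] _|c w [|//] cA _ c0]; first exact: oner_neq0.
rewrite big_ord1 /= mulr1 deg1.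
suff /deg_nat[n ->] : c 0%N + x * w != 0 by [].
rewrite addr_eq0; apply: contraTneq isT => /(congr1 deg).
rewrite degN degM xe (deg_filt0 deg_nat (cA _) c0).
have [->|/deg_nat[n ->]] := eqVneq w 0; first by rewrite deg0.
by move=> -[]; lia.
Qed.

Lemma x_transcendental (p : {poly B}) : (forall j, p`_j \in A) -> p.[x] = 0 -> p = 0.
Proof.
move=> pA px; apply: (@orthogonal_independent [:: 1] (fun=> p) orthogonal1 _ _ 0%N) => //.
by rewrite big_ord1 px mul0r.
Qed.

(** * Finiteness over the field of fractions of $A[x]$ *)

Section FunctionField.
Hypothesis charB : [pchar B] =i pred0.
Hypothesis ff : one_dim_function_field (frac_subring (fun z => le_bot (deg z) (Some 0))).
Let K : L -> Prop := frac_subring (fun z => le_bot (deg z) (Some 0)).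
Let F : {pred L} := frac_pred (tofrac_image (horner_image A x)).

Lemma K_sub_frac z : K z -> z \in frac_pred (tofrac_image A).
Proof.
case=> a [b [a0 b0 nb ->]]; apply/frac_predP; exists (tofrac a), (tofrac b).
by rewrite tofrac_eq0 nb; split=> //; apply/tofrac_imageP; [exists a|exists b].
Qed.

Lemma F_closed : divring_closed F.
Proof. exact/frac_pred_closed/tofrac_image_closed/horner_image_closed/filt0_closed. Qed.

Lemma K_sub_F z : K z -> z \in F.
Proof.
case/K_sub_frac/frac_predP=> a [b [/tofrac_imageP[a' a0 aE] /tofrac_imageP[b' b0 bE] nb ->]].
have sub := sub_horner_image x (filt0_closed deg).
apply/frac_predP; exists a, b; split=> //; apply/tofrac_imageP.
  by exists a' => //; apply: sub.
by exists b' => //; apply: sub.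
Qed.

(** If [tau] is a transcendence basis over [K], then [x], transcendental over [K] but algebraic over
    $K(\tau)$, can be exchanged with it. *)
Lemma function_field_algebraic y : algebraic_over (fun z => z \in F) y.
Proof.
have [_ [tau [_ algtau]]] := ff.
pose S0 (z : L) := False.
have gtau : alg_closure K (add_elt S0 (tau ord0)) (tofrac x).
  by apply: alg_closure_mono (algtau (tofrac x)) => z [i ->]; left; rewrite (ord1 i).
have nx : ~ alg_closure K S0 (tofrac x).
  move=> clx; have Ar := filt0_closed deg.
  have [p [p0 pA px]] : exists p : {poly B}, [/\ p != 0, forall i, p`_i \in A & p.[x] = 0].
    apply: algebraic_over_tofrac => //; apply: algebraic_over_sub clx => z; apply => //.
      exact/frac_pred_closed/tofrac_image_closed.
    exact: K_sub_frac.
  by case/eqP: p0; apply: x_transcendental.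
have xtau := alg_closure_exchange gtau nx.
have : alg_closure K (add_elt S0 (tofrac x)) y.
  by apply: alg_closure_sub (algtau y) => z [i ->]; rewrite (ord1 i).
apply: algebraic_over_sub => z; apply; first exact: F_closed.
  exact: K_sub_F.
have hr := horner_image_closed x (filt0_closed deg).
move=> w [->|//]; apply/(sub_frac_pred (tofrac_image_closed hr))/tofrac_imageP.
by exists x; [exact: (mem_horner_image x (filt0_closed deg)) | exact: erefl].
Qed.

(** A linear relation over [F] among [d] elements becomes, after clearing denominators, a relation
    over $A[x]$, which an orthogonal family forbids. *)
Lemma orthogonal_size : exists d, forall y, orthogonal_mod y -> size y <> d.
Proof.
have [[s gens] _] := ff.
pose F' : divringClosed L := HB.pack F (GRing.isDivringClosed.Build L F F_closed).
have charL : [pchar L] =i pred0.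
  by move=> p; rewrite -charB !inE -(rmorph_nat (@tofrac B)) tofrac_eq0.
have [||d dep] := @finite_dependence L charL F' s.
- by move=> y _; apply: function_field_algebraic.
- by move=> y C Cf CF Cs; apply: gens => // z /K_sub_F /CF.
exists d => y orth yd; have [c [cF [i id ci0] sum0]] := dep (fun i => tofrac y`_i).
have hr := tofrac_image_closed (horner_image_closed x (filt0_closed deg)).
have [z|b [_ b0 bc]] := @common_denominator _ _ (mkseq c d) hr.
  by case/mapP=> j _ ->; apply: cF.
have /choice[p pP] j : exists p : {poly B}, (forall l, p`_l \in A) /\
    ((j < d)%N -> b * c j = tofrac p.[x]).
  have [jd|jd] := ltnP j d; last first.
    by exists 0; split=> // l; rewrite coef0; apply/subring_closed0/filt0_closed.
  have /tofrac_imageP[_ /horner_imageP[p pA ->] E] :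
      b * c j \in tofrac_image (horner_image A x).
    by apply: bc; apply/mapP; exists j; rewrite ?mem_iota.
  by exists p.
have pi0 : p i = 0.
  apply: (orthogonal_independent orth) => [j||]; rewrite ?yd //; first by case: (pP j).
  apply/eqP; rewrite -tofrac_eq0; apply/eqP.
  transitivity (b * \sum_(i < d) c i * tofrac y`_i); last by rewrite sum0 mulr0.
  rewrite rmorph_sum mulr_sumr /=; apply: eq_bigr => j _.
  by rewrite rmorphM /= mulrA (pP j).2.
have /eqP := (pP i).2 id; rewrite pi0 horner0 rmorph0 mulf_eq0 (negPf b0).
by rewrite (negPf ci0).
Qed.

(** Otherwise the empty family could be extended step by step up to the excluded size [d]. *)
Lemma exists_maximal_orthogonal :
  exists2 y, orthogonal_mod y & forall z, ~ orthogonal_mod (z :: y).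
Proof.
apply: contrapT => nomax; have [d dP] := orthogonal_size.
suff [y orth yd] : exists2 y, orthogonal_mod y & size y = d by apply: (dP y).
elim: d {dP} => [|d [y orth yd]]; first by exists [::].
have [z zy] : exists z, orthogonal_mod (z :: y).
  apply: contrapT => nz; apply: nomax; exists y => // z zy; apply: nz; by exists z.
by exists (z :: y); rewrite //= yd.
Qed.

Lemma maximal_orthogonal_generates y z d : orthogonal_mod y ->
  ~ orthogonal_mod (z :: y) -> deg z = Some d ->
  exists a (c : nat -> B) w, [/\ a \in A, a != 0, forall i, c i \in A &
    lt_bot (deg (a * z + (\sum_(i < size y) c i * y`_i + x * w))) (Some d)].
Proof.
move=> orth nzy zd; have [y0 orthy] := orth; apply: contrapT => nex; apply: nzy; split.
  case=> [_|j]; last exact: y0.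
  by apply/eqP => /(deg_eq_bot deg); rewrite zd.
move=> c w j cA; rewrite big_ord_recl /=; set s := \sum_(i < size y) _.
rewrite -addrA; have [c00|c00] := eqVneq (c 0%N) 0.
  case: j => [|j] jy cj; first by rewrite c00 eqxx in cj.
  rewrite c00 mul0r add0r; exact: (orthy (fun i => c i.+1)).
(* As no combination with a non-zero coefficient at [z] drops below [d], the term $c_0 z$, of degree
   [d], never exceeds the whole sum; subtracting it shows that the rest does not either. *)
have dle : le_bot (Some d) (deg (c 0%N * z + (s + x * w))).
  apply: contrapT => nle; apply: nex; exists (c 0%N), (fun i => c i.+1), w.
  by split=> //; apply/negP.
case: j => [_ _|j jy cj] /=; first by rewrite zd.
apply: contrapT => /negP nle; have := orthy (fun i => c i.+1) w j (fun i => cA i.+1) jy cj.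
rewrite -/s; set v := deg (s + x * w) => yv.
have vd : le_bot v (deg (c 0%N * z + (s + x * w))).
  rewrite /v -[X in deg X](addKr (c 0%N * z)) addrC; apply: deg_leB; first exact: le_bot_refl.
  by apply: le_bot_trans dle; rewrite degM zd (deg_filt0 deg_nat) //= add0r.
by case/negP: nle; apply: le_bot_trans yv vd.
Qed.

End FunctionField.

End OneDimensional.

(** * Case (c): one-dimensional function fields *)

Lemma tame_of_one_dim (k : fieldType) (B : idomainType) (iota : {rmorphism k -> B})
    (deg : degree_function B int) :
  [pchar k] =i pred0 -> finite_trdeg_domain iota ->
  one_dim_function_field (frac_subring (fun x => le_bot (deg x) (Some 0))) ->
  values_in_nat deg -> tame iota deg.
Proof.
move=> char0 ftr ff deg_nat D [derD Diota].
have [M0 M0P] := controlled_on_filt0 char0 deg_nat derD Diota ftr.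
have charB : [pchar B] =i pred0 by move=> p; rewrite (fmorph_pchar iota) char0.
have [[x [n xn]]|triv] := pselect (exists x n, deg x = Some n.+1%:Z); last first.
  apply: (bounded_shifts_defined deg_nat derD (M := M0)) => z.
  have [->|z0] := eqVneq z 0; first by rewrite derivation0 // deg0.
  have [[|m] zm] := deg_nat z z0; last by case: triv; exists z, m.
  by have [] : controlled deg D (Some M0) 0 z; [apply: M0P; rewrite unfold_in zm | rewrite zm].
have e0 : 0 < n.+1%:Z by [].
have [y orth maxy] := exists_maximal_orthogonal deg_nat e0 xn charB ff.
have [M [MP My]] := controlled_common_bound derD (x :: y) M0P.
apply: (bounded_shifts_defined deg_nat derD (M := M)).
apply: (controlled_by_generation deg_nat derD MP e0 _ xn).
  by apply: My; rewrite ?mem_head.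
move=> z d zd.
have [a [c [w [a0 an0 cA]]]] := maximal_orthogonal_generates deg_nat orth (maxy z) zd.
set s := \sum_(i < _) _ => ltd.
exists a, (- s), (- w); split=> //; last by rewrite opprK mulrN opprK -addrA.
apply: controlledN => //; rewrite /s -(big_mkord xpredT (fun i => c i * y`_i)) big_seq.
elim/big_rec: _ => [|i v]; first exact: controlled0.
rewrite mem_index_iota => /= iy; apply: controlledD => //.
have [->|ci0] := eqVneq (c i) 0; first by rewrite mul0r; apply: controlled0.
(* Orthogonality excludes cancellation: [y_i] has degree at most that of $s + xw$, which differs
   from $-az$ by terms of degree less than [d]. *)
have : le_bot (deg y`_i) (Some d).
  apply: le_bot_trans (orth.2 c w i cA iy ci0) _.
  rewrite -/s -[X in deg X](addKr (a * z)) addrC; apply: deg_leB; first exact: lt_botW.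
  by rewrite degM zd (deg_filt0 deg_nat) //= add0r.
have [m ym] := deg_nat _ (orth.1 i iy); rewrite ym /= => md.
apply: (controlled_le md).
have yM : controlled deg D (Some M) m y`_i by apply: My; rewrite ?inE ?mem_nth ?orbT.
exact: (controlledM derD (add0r _) (MP _ (cA i)) yM).
Qed.

Theorem theorem1p7 (k : fieldType) (B : idomainType)
    (iota : {rmorphism k -> B}) (char0 : [pchar k] =i pred0) :
  [/\ (* (a) *)
      forall (G : toagType) (deg : degree_function B G),
        fg_algebra iota ->
        (exists2 Bi : G -> B -> Prop, is_grading Bi & determined_by Bi deg) ->
        tame iota deg,
      (* (b) *)
      forall (G : toagType) (deg : degree_function B G)
             (wo : well_ordered_values deg),
        fg_algebra (gr_scalar iota wo) ->
        tame iota deg,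
      (* (c) *)
      forall deg : degree_function B int,
        finite_trdeg_domain iota ->
        one_dim_function_field
          (frac_subring (fun x => le_bot (deg x) (Some 0))) ->
        values_in_nat deg ->
        tame iota deg
    & (* (d) *)
      forall deg : degree_function B int,
        finite_trdeg_domain iota ->
        (exists Delta : B -> B, [/\ derivation Delta, locally_nilpotent Delta
                                  & is_deg_of_lnd Delta deg]) ->
        tame iota deg].
Proof.
split.
- by move=> G deg fg [Bi gr degE]; apply: tame_of_fg_graded gr _ _ _ degE fg.
- by move=> G deg wo; apply: tame_of_fg_gr.
- by move=> deg ftr ff degN; apply: tame_of_one_dim.
- by move=> deg ftr [Delta [derDelta _ degE]]; apply: tame_of_lnd derDelta degE _ _ char0 ftr.
Qed.
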